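(* Let $\beta=(B,(B_i)_{i\in I_\beta})$ be a regular hypertope, let $j\in I_\beta$ be such that $X_j=\{\sigma B_j\mid\sigma\in B\}$ is finite with more than one element, let $\mathcal{D}=\mathcal{D}(\beta,j,\lambda)$ be a $j$-diagonal Coxeter graph, and let $\mathcal{G}$ be a finite Coxeter graph with a distinguished vertex. Form $\mathcal{K}=\operatorname{Ext}(\mathcal{G},\mathcal{D})$ by identifying the distinguished vertex of $\mathcal{G}$ with $B_j\in V(\mathcal{D})$. Let $A=W(\mathcal{K})$, let $\alpha=(A,(A_i)_{i\in V(\mathcal{K})})$ be its standard coset incidence system, and let $\eta:B\to\operatorname{Aut}(A)$ be the induced action. Then: (a) The twisting $\mathcal{T}(\alpha,\beta)$ is a regular hypertope, where $F_L=B_j$ is the chosen representative of the orbit $L=V(\mathcal{D})$. (b) If $M\le A$ is invariant under $\eta(B)$ (i.e. $\eta(b)(M)=M$ for all $b\in B$), let $N=\langle\!\langle M\rangle\!\rangle_A$ be the normal closure of $M$ in $A$ and set $\widetilde\alpha=\bigl(A/N,(A_iN/N)_{i\in V(\mathcal{K})}\bigr)$. If $\widetilde\alpha$ is a regular hypertope, then the twisting $\mathcal{T}(\widetilde\alpha,\beta)$ (with respect to the action of $B$ on $A/N$ induced by $\eta$, and $F_L=B_j$) is a regular hypertope.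
   Context: Coset incidence systems. Given a group $B$ and a family $(B_i)_{i\in I_\beta}$ of subgroups (the maximal parabolic subgroups), the coset incidence system $\beta=(B,(B_i)_{i\in I_\beta})$ has as elements of type $i$ the left cosets $bB_i$; two cosets are incident if they intersect. $B$ acts by left multiplication. For $J\subseteq I_\beta$, $B_J=\bigcap_{i\in J}B_i$ and $B_\emptyset=B$. A flag is a set of pairwise incident elements (distinct incident elements have different types), a chamber is a flag with an element of every type, and the system is an incidence geometry if every maximal flag is a chamber. Regular hypertopes. A regular hypertope is an incidence geometry that is thin (every rank-one residue has exactly two elements), residually connected (every residue of rank at least two has connected incidence graph), and has a flag-transitive automorphism group. When a coset incidence system $(B,(B_i)_{i\in I_\beta})$ is called a regular hypertope, $B$ itself is its (type-preserving) automorphism group, i.e. $B$ acts faithfully and flag-transitively (transitively on the flags of each given type set). Coxeter graphs. A Coxeter graph $\mathcal{G}$ is a simple graph with edges labelled by elements of $\{3,4,\ldots\}\cup\{\infty\}$; $m_{s,t}$ is the label of $\{s,t\}$, and $m_{s,t}=2$ for distinct non-adjacent $s,t$. $W(\mathcal{G})$ is generated by $a_s$ ($s\in V(\mathcal{G})$) with defining relations $a_s^2=1$ and $(a_sa_t)^{m_{s,t}}=1$ when $m_{s,t}<\infty$. Its standard coset incidence system is $(W(\mathcal{G}),(W(\mathcal{G})_s)_{s\in V(\mathcal{G})})$ with $W(\mathcal{G})_s=\langle a_t\mid t\ne s\rangle$. Diagonal Coxeter graph. A $j$-diagonal is an unordered pair $\{F_1,F_2\}$ of distinct elements of $X_j$.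 Two $j$-diagonals are equivalent if some $b\in B$ maps one to the other (as unordered pairs); the class is $[F_1,F_2]$ and $\mathcal{C}^j_\beta$ is the set of classes. Given a label function $\lambda:\mathcal{C}^j_\beta\to\{2,3,\ldots\}\cup\{\infty\}$, $\mathcal{D}(\beta,j,\lambda)$ has vertex set $X_j$, with distinct $F_1,F_2$ joined iff $\lambda([F_1,F_2])\ne2$, the edge then being labelled $\lambda([F_1,F_2])$. Extension. Let $\mathcal{G},\mathcal{D}$ be Coxeter graphs with distinguished vertices $v_{\mathcal{G}},v_{\mathcal{D}}$ and otherwise disjoint vertex sets. $\mathcal{K}=\operatorname{Ext}(\mathcal{G},\mathcal{D})$ has vertex set obtained from $V(\mathcal{G})\sqcup V(\mathcal{D})$ by identifying $v_{\mathcal{G}}$ and $v_{\mathcal{D}}$ to one vertex $v$; all edges of $\mathcal{G}$ and $\mathcal{D}$ remain with their labels; if $w\in V(\mathcal{G})\setminus\{v\}$ is joined to $v$ in $\mathcal{G}$ with label $m$, then $w$ is joined to every $w'\in V(\mathcal{D})\setminus\{v\}$ with label $m$; there are no other edges. Here $v_{\mathcal{D}}=B_j$. Action. $B$ acts on $V(\mathcal{K})$ by fixing each vertex of $V(\mathcal{G})\setminus\{v\}$ and by left multiplication on $V(\mathcal{D})=X_j$; $\eta(b)(a_s)=a_{b\cdot s}$ for $s\in V(\mathcal{K})$. Twisting. Let $\alpha=(A,(A_i)_{i\in I_\alpha})$ and $\beta=(B,(B_i)_{i\in I_\beta})$ be coset incidence systems and $\eta:B\to\operatorname{Aut}(A)$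 an action permuting the maximal parabolic subgroups of $\alpha$, so that $B$ acts on $I_\alpha$ with $\eta(b)(A_i)=A_{b\cdot i}$. Let $\Omega$ be the set of orbits on $I_\alpha$ and for each $L\in\Omega$ choose $F_L\in L$. For $M\subseteq I_\beta$ put $\mathcal{O}_L(M)=B_{I_\beta\setminus M}\cdot F_L$. Then $\alpha$ is $(\beta,\eta)$-admissible if $\mathcal{O}_L(M)\cap\mathcal{O}_L(N)=\mathcal{O}_L(M\cap N)$ for all $L\in\Omega$, $M,N\subseteq I_\beta$. In that case the twisting $\mathcal{T}(\alpha,\beta)$ is the coset incidence system $(G,(G_i)_{i\in I_\beta\sqcup\Omega})$ with $G=A\rtimes_\eta B$, $G_i=A_{\bigcup_{L\in\Omega}(L\setminus\mathcal{O}_L^i)}\rtimes B_i$ for $i\in I_\beta$, where $\mathcal{O}_L^i=B_i\cdot F_L$, and $G_L=A_L\rtimes B$ for $L\in\Omega$; here $A_J=\bigcap_{i\in J}A_i$ for $J\subseteq I_\alpha$, $A_\emptyset=A$. For singleton orbits the representative is the only element. (That the admissibility condition holds is part of the assertion.) *)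

(* Defs.v *)
From HB Require Import structures.
From Stdlib Require Import Relation_Operators.
From mathcomp Require Import all_boot.
From mathcomp Require Import generic_quotient monoid.
From mathcomp Require Import boolp classical_sets functions cardinality.

Set Implicit Arguments.
Unset Strict Implicit.
Unset Printing Implicit Defensive.

Local Open Scope classical_set_scope.
Local Open Scope quotient_scope.
Local Open Scope group_scope.

Section Subgroups.
Variable G : groupType.
Implicit Types (H S : set G) (g x y : G).

Definition is_subgroup H : Prop :=
  [/\ H 1, forall x y, H x -> H y -> H (x * y) & forall x, H x -> H x^-1].

Definition is_normal_subgroup H : Prop :=
  is_subgroup H /\ forall g x, H x -> H (g * x * g^-1).

Definition lcoset g H : set G := [set g * x | x in H].

Definition generated S : set G := smallest is_subgroup S.

Definition normal_closure S : set G := smallest is_normal_subgroup S.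

Lemma generated_subgroup S : is_subgroup (generated S).
Proof.
split=> [H [[] //]|x y xS yS H HS|x xS H HS]; have [[H1 HM HV] _] := HS.
- by apply: HM; [apply: xS | apply: yS].
- by apply: HV; apply: xS.
Qed.

Lemma normal_closure_normal S : is_normal_subgroup (normal_closure S).
Proof.
split=> [|g x xS H HS]; last by apply: HS.1.2; apply: xS.
split=> [H [[[]] //]|x y xS yS H HS|x xS H HS]; have [[[H1 HM HV] _] _] := HS.
- by apply: HM; [apply: xS | apply: yS].
- by apply: HV; apply: xS.
Qed.

End Subgroups.

Record subgroup (G : groupType) := Subgroup {
  sg_set :> set G;
  sgP : is_subgroup sg_set }.

Record normal_subgroup (G : groupType) := NormalSubgroup {
  nsg_set :> set G;
  nsgP : is_normal_subgroup nsg_set }.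

Definition nclosure (G : groupType) (S : set G) : normal_subgroup G :=
  NormalSubgroup (normal_closure_normal S).

Lemma lcosetM (G : groupType) (b c : G) (X : set G) :
  lcoset (b * c) X = lcoset b (lcoset c X).
Proof.
apply/seteqP; split=> [_ [x Xx <-]|_ [_ [x Xx <-] <-]].
  by exists (c * x); [exists x | rewrite mulgA].
by exists x; rewrite ?mulgA.
Qed.

Lemma lcoset1 (G : groupType) (X : set G) : lcoset 1 X = X.
Proof.
apply/seteqP; split=> [_ [x Xx <-]|x Xx]; first by rewrite mul1g.
by exists x; rewrite ?mul1g.
Qed.

Definition lcosets (G : groupType) (H : set G) : set (set G) :=
  [set X | exists g, X = lcoset g H].

Definition coset_space (G : groupType) (H : set G) : Type :=
  set_type (lcosets H).
HB.instance Definition _ (G : groupType) (H : set G) :=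
  Choice.on (coset_space H).

Lemma lcosets_self (G : groupType) (H : set G) : H \in lcosets H.
Proof. by apply/mem_set; exists 1; rewrite lcoset1. Qed.

Definition base_coset (G : groupType) (H : set G) : coset_space H :=
  exist _ H (lcosets_self H).

Record action (B : groupType) (T : Type) := Action {
  act :> B -> T -> T;
  act1 : forall x, act 1 x = x;
  actM : forall b c x, act (b * c) x = act b (act c x) }.

(* Equivalently, a homomorphism from B to Aut(A). *)
Record group_action (B A : groupType) := GroupAction {
  gact :> action B A;
  gactM : forall b, {morph gact b : x y / x * y} }.

Section GroupActionTheory.
Variables (B A : groupType) (eta : group_action B A).

Lemma gact1 b : eta b 1 = 1.
Proof. by apply: (@mulIg _ (eta b 1)); rewrite -gactM !mul1g. Qed.

Lemma gactV b x : eta b x^-1 = (eta b x)^-1.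
Proof. by apply/esym/mulg1_eq; rewrite -gactM mulgV gact1. Qed.

Lemma gact_preimage b (H : set A) :
  is_subgroup H -> is_subgroup (eta b @^-1` H).
Proof.
move=> [H1 HM HV]; split=> [|y z Hy Hz|y Hy] /=; rewrite ?gact1 ?gactM ?gactV //.
- exact: HM.
- exact: HV.
Qed.

End GroupActionTheory.

Section CosetAction.
Variables (G : groupType) (H : set G).

Lemma lcosets_lcoset (b : G) (X : coset_space H) :
  lcoset b (val X) \in lcosets H.
Proof.
case: X => X XP; apply/mem_set; have [g /= ->] := set_mem XP.
by exists (b * g); rewrite lcosetM.
Qed.

Definition coset_translate (b : G) (X : coset_space H) : coset_space H :=
  exist _ (lcoset b (val X)) (lcosets_lcoset b X).

Lemma coset_translate1 X : coset_translate 1 X = X.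
Proof. by apply: val_inj; rewrite /= lcoset1. Qed.

Lemma coset_translateM b c X :
  coset_translate (b * c) X = coset_translate b (coset_translate c X).
Proof. by apply: val_inj; rewrite /= lcosetM. Qed.

Definition coset_action : action G (coset_space H) :=
  Action coset_translate1 coset_translateM.

End CosetAction.

Record cosys := CoSys {
  grp : groupType;
  typ : Type;
  par : typ -> subgroup grp }.

Section CosetIncidence.
Variable beta : cosys.

Local Notation B := (grp beta).
Local Notation I := (typ beta).

(* An element of type i is the pair of i and a left coset of [par i]: equal
   cosets of different types are different elements. *)
Definition elements : set (I * set B) := [set x | lcosets (par x.1) x.2].

Definition incident (x y : I * set B) : Prop := x.2 `&` y.2 !=set0.

(* Incidence is reflexive, and distinct cosets of one subgroup are disjoint,
   so distinct incident elements have different types. *)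
Definition flag (F : set (I * set B)) : Prop :=
  F `<=` elements /\ forall x y, F x -> F y -> incident x y.

Definition type_set (F : set (I * set B)) : set I := fst @` F.

Definition chamber F : Prop := flag F /\ type_set F = setT.

Definition maximal_flag F : Prop :=
  flag F /\ forall F', flag F' -> F `<=` F' -> F' = F.

Definition incidence_geometry : Prop := forall F, maximal_flag F -> chamber F.

(* The rank of the residue of F is the number of types not in [type_set F]. *)
Definition residue (F : set (I * set B)) : set (I * set B) :=
  [set x | [/\ elements x, ~ F x & forall y, F y -> incident x y]].

Definition thin : Prop :=
  forall F, flag F -> (exists i, ~` type_set F = [set i]) ->
    exists x y, x <> y /\ residue F = [set x; y].

Definition incidence_connected (S : set (I * set B)) : Prop :=
  forall x y, S x -> S y ->
    clos_refl_trans _ (fun u v => [/\ S u, S v & incident u v]) x y.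

Definition residually_connected : Prop :=
  forall F, flag F ->
    (exists i k, [/\ i <> k, ~ type_set F i & ~ type_set F k]) ->
    incidence_connected (residue F).

Definition translate (b : B) (x : I * set B) : I * set B :=
  (x.1, lcoset b x.2).

Definition faithful : Prop :=
  forall b, (forall x, elements x -> translate b x = x) -> b = 1.

Definition flag_transitive : Prop :=
  forall F F', flag F -> flag F' -> type_set F = type_set F' ->
    exists b, translate b @` F = F'.

(* The automorphism group of the hypertope is B itself, acting by left
   multiplication: the last two conditions are about this action. *)
Definition regular_hypertope : Prop :=
  [/\ incidence_geometry, thin, residually_connected, faithful
    & flag_transitive].

(* [parJ set0] is the whole group. *)
Definition parJ (J : set I) : set B := \bigcap_(i in J) (par i : set B).

Lemma parJ_subgroup J : is_subgroup (parJ J).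
Proof.
split=> [i _|x y xJ yJ i Ji|x xJ i Ji]; have [p1 pM pV] := sgP (par i).
- exact: p1.
- by apply: pM; [apply: xJ | apply: yJ].
- by apply: pV; apply: xJ.
Qed.

End CosetIncidence.

Definition sdprod (B A : groupType) (eta : group_action B A) : Type :=
  (A * B)%type.

Section SemidirectProduct.
Variables (B A : groupType) (eta : group_action B A).
Implicit Types x y z : sdprod eta.

HB.instance Definition _ := Choice.on (sdprod eta).

Definition sd_one : sdprod eta := (1, 1).
Definition sd_inv x : sdprod eta := (eta x.2^-1 x.1^-1, x.2^-1).
Definition sd_mul x y : sdprod eta := (x.1 * eta x.2 y.1, x.2 * y.2).

Fact sd_mulA : associative sd_mul.
Proof. by move=> x y z; rewrite /sd_mul /= gactM actM !mulgA. Qed.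

Fact sd_mul1 : left_id sd_one sd_mul.
Proof. by case=> a b; rewrite /sd_mul /= act1 !mul1g. Qed.

Fact sd_1mul : right_id sd_one sd_mul.
Proof. by case=> a b; rewrite /sd_mul /= gact1 !mulg1. Qed.

Fact sd_mulV : left_inverse sd_one sd_inv sd_mul.
Proof. by case=> a b; rewrite /sd_mul /= -gactM !mulVg gact1. Qed.

Fact sd_Vmul : right_inverse sd_one sd_inv sd_mul.
Proof. by case=> a b; rewrite /sd_mul /= -actM !mulgV act1 mulgV. Qed.

HB.instance Definition _ := isGroup.Build (sdprod eta)
  sd_mulA sd_mul1 sd_1mul sd_mulV sd_Vmul.

End SemidirectProduct.

(* An action of the group of [beta] on the group of [alpha] by automorphisms
   that permutes the maximal parabolic subgroups of [alpha], together with the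
   resulting action on types. *)
Record parabolic_action (alpha beta : cosys) := ParabolicAction {
  pact : group_action (grp beta) (grp alpha);
  tact : action (grp beta) (typ alpha);
  pact_par : forall b i, pact b @` par i = par (tact b i) }.

Section Twisting.
Variables (alpha beta : cosys) (eta : parabolic_action alpha beta).

Definition type_orbit (i : typ alpha) : set (typ alpha) :=
  [set tact eta b i | b in setT].

Definition orbits : Type := set_type [set L | exists i, L = type_orbit i].

Record orbit_choice := OrbitChoice {
  orep :> orbits -> typ alpha;
  orepP : forall L, val L (orep L) }.

Variable F : orbit_choice.

Definition sub_orbit (L : orbits) (M : set (typ beta)) : set (typ alpha) :=
  [set tact eta b (F L) | b in parJ (~` M)].

Definition admissible : Prop :=
  forall (L : orbits) (M N : set (typ beta)),
    sub_orbit L M `&` sub_orbit L N = sub_orbit L (M `&` N).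

Definition par_orbit (L : orbits) (i : typ beta) : set (typ alpha) :=
  [set tact eta b (F L) | b in par i].

Lemma pact_parJ (J : set (typ alpha)) b :
  (forall i, J i -> J (tact eta b^-1 i)) ->
  forall a, parJ J a -> parJ J (pact eta b a).
Proof.
move=> JS a aJ i /JS/aJ => ai.
have := pact_par eta b (tact eta b^-1 i).
by rewrite -actM mulgV act1 => <-; exists a.
Qed.

Lemma orbit_act (L : orbits) b i : val L i -> val L (tact eta b i).
Proof.
case: L => L LP /=; have [k /= ->] := set_mem LP.
by case=> c _ <-; exists (b * c) => //; rewrite actM.
Qed.

(* The subgroup [A_J] ⋊ [H]; the hypothesis makes [A_J] stable under [H]. *)
Lemma sd_subgroupP (J : set (typ alpha)) (H : set (grp beta)) :
  is_subgroup H -> (forall b i, H b -> J i -> J (tact eta b i)) ->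
  is_subgroup [set x : sdprod (pact eta) | parJ J x.1 /\ H x.2].
Proof.
move=> [H1 HM HV] JS; have [J1 JM JV] := parJ_subgroup J.
have JS' b a : H b -> parJ J a -> parJ J (pact eta b a).
  by move=> Hb; apply: pact_parJ => i; apply/JS/HV.
split=> [|[a b] [a' b'] /= [Ja Hb] [Ja' Hb']|[a b] /= [Ja Hb]]; first by split.
- by split; [apply/JM/JS' | apply: HM].
- by split; [apply/JS'/JV => //; apply: HV | apply: HV].
Qed.

Lemma twist_base_stable (i : typ beta) b k : (par i : set _) b ->
  (\bigcup_(L : orbits) (val L `\` par_orbit L i)) k ->
  (\bigcup_(L : orbits) (val L `\` par_orbit L i)) (tact eta b k).
Proof.
move=> ib [L _ [Lk nk]]; exists L => //; split; first exact: orbit_act.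
case=> c ic eqk; apply: nk; have [_ pM pV] := sgP (par i).
exists (b^-1 * c); first by apply: pM => //; apply: pV.
by rewrite actM eqk -actM mulVg act1.
Qed.

Lemma setT_subgroup (G : groupType) : is_subgroup [set: G].
Proof. by []. Qed.

Definition twist_base (i : typ beta) : subgroup (sdprod (pact eta)) :=
  Subgroup (sd_subgroupP (sgP (par i)) (@twist_base_stable i)).

Definition twist_orbit (L : orbits) : subgroup (sdprod (pact eta)) :=
  Subgroup (sd_subgroupP (@setT_subgroup _) (fun b i _ => @orbit_act L b i)).

Definition twisting : cosys := {|
  grp := sdprod (pact eta);
  typ := (typ beta + orbits)%type;
  par := fun t => match t with
                  | inl i => twist_base i
                  | inr L => twist_orbit L
                  end |}.

End Twisting.

Section QuotientGroup.
Variables (A : groupType) (N : normal_subgroup A).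

Definition quot_rel (x y : A) : bool := `[< (N : set A) (x^-1 * y) >].

Fact quot_rel_refl : reflexive quot_rel.
Proof. by move=> x; apply/asboolP; rewrite mulVg; case: (nsgP N) => -[]. Qed.

Fact quot_rel_sym : symmetric quot_rel.
Proof.
have [[_ _ NV] _] := nsgP N.
move=> x y; apply/asboolP/asboolP => /NV; by rewrite invgM invgK.
Qed.

Fact quot_rel_trans : transitive quot_rel.
Proof.
have [[_ NM _] _] := nsgP N.
move=> y x z /asboolP xy /asboolP yz; apply/asboolP.
by have := NM _ _ xy yz; rewrite -mulgA mulVKg.
Qed.

Canonical quot_equiv := EquivRel quot_rel quot_rel_refl quot_rel_sym
  quot_rel_trans.

Definition quot_group : Type := {eq_quot quot_equiv}.
HB.instance Definition _ := Choice.on quot_group.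

Definition quot_pi (x : A) : quot_group := \pi_({eq_quot quot_equiv}) x.
Definition quot_repr (x : quot_group) : A :=
  repr (x : {eq_quot quot_equiv}).

Lemma quot_reprK : cancel quot_repr quot_pi.
Proof. exact: reprK. Qed.

Lemma quot_piP x y : quot_pi x = quot_pi y <-> (N : set A) (x^-1 * y).
Proof.
by split=> [/eqmodP/asboolP //|xy]; apply/eqmodP/asboolP.
Qed.

Definition quot_one : quot_group := quot_pi 1.
Definition quot_inv (x : quot_group) := quot_pi (quot_repr x)^-1.
Definition quot_mul (x y : quot_group) := quot_pi (quot_repr x * quot_repr y).

Lemma quot_reprP x : (N : set A) ((quot_repr (quot_pi x))^-1 * x).
Proof. by apply/quot_piP; rewrite quot_reprK. Qed.

Lemma quot_mul_pi x y : quot_mul (quot_pi x) (quot_pi y) = quot_pi (x * y).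
Proof.
have [[_ NM _] NJ] := nsgP N; apply/quot_piP; rewrite invgM.
have /(NJ y^-1) := quot_reprP x; rewrite invgK => xN.
have := NM _ _ (quot_reprP y) xN.
by rewrite !mulgA mulgK.
Qed.

Lemma quot_inv_pi x : quot_inv (quot_pi x) = quot_pi x^-1.
Proof.
have [[_ NM NV] NJ] := nsgP N; apply/quot_piP; rewrite invgK.
have /NV := quot_reprP x; rewrite invgM invgK => xN.
by have := NJ x _ xN; rewrite !mulgA mulgV mul1g.
Qed.

Fact quot_mulA : associative quot_mul.
Proof.
move=> x y z; rewrite -[x]quot_reprK -[y]quot_reprK -[z]quot_reprK.
by rewrite !quot_mul_pi mulgA.
Qed.

Fact quot_mul1 : left_id quot_one quot_mul.
Proof. by move=> x; rewrite -[x]quot_reprK quot_mul_pi mul1g. Qed.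

Fact quot_1mul : right_id quot_one quot_mul.
Proof. by move=> x; rewrite -[x]quot_reprK quot_mul_pi mulg1. Qed.

Fact quot_mulV : left_inverse quot_one quot_inv quot_mul.
Proof.
by move=> x; rewrite -[x]quot_reprK quot_inv_pi quot_mul_pi mulVg.
Qed.

Fact quot_Vmul : right_inverse quot_one quot_inv quot_mul.
Proof.
by move=> x; rewrite -[x]quot_reprK quot_inv_pi quot_mul_pi mulgV.
Qed.

HB.instance Definition _ := isGroup.Build quot_group
  quot_mulA quot_mul1 quot_1mul quot_mulV quot_Vmul.

Lemma quot_piM : {morph quot_pi : x y / x * y}.
Proof. by move=> x y; rewrite -quot_mul_pi. Qed.

Lemma quot_piV x : quot_pi x^-1 = (quot_pi x)^-1.
Proof. by rewrite -quot_inv_pi. Qed.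

Lemma quot_pi_subgroup (H : set A) :
  is_subgroup H -> is_subgroup (quot_pi @` H).
Proof.
move=> [H1 HM HV]; split; first by exists 1.
- move=> _ _ [x Hx <-] [y Hy <-]; exists (x * y); first exact: HM.
  exact: quot_piM.
- by move=> _ [x Hx <-]; exists x^-1; [apply: HV | apply: quot_piV].
Qed.

End QuotientGroup.

(* The image of [par i] in [A / N] is [A_i N / N]. *)
Definition quot_cosys (alpha : cosys) (N : normal_subgroup (grp alpha)) :
    cosys := {|
  grp := quot_group N;
  typ := typ alpha;
  par := fun i => Subgroup (quot_pi_subgroup N (sgP (par i))) |}.

Section QuotientAction.
Variables (B A : groupType) (eta : group_action B A) (N : normal_subgroup A).
Hypothesis etaN : forall b, eta b @` N = N.

Definition quot_act (b : B) (x : quot_group N) : quot_group N :=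
  quot_pi N (eta b (quot_repr x)).

Lemma quot_act_pi b x : quot_act b (quot_pi N x) = quot_pi N (eta b x).
Proof.
apply/quot_piP; rewrite -gactV -gactM -[X in X _](etaN b).
by exists ((quot_repr (quot_pi N x))^-1 * x) => //; apply: quot_reprP.
Qed.

Fact quot_act1 x : quot_act 1 x = x.
Proof. by rewrite -[x]quot_reprK quot_act_pi act1. Qed.

Fact quot_actM b c x : quot_act (b * c) x = quot_act b (quot_act c x).
Proof. by rewrite -[x]quot_reprK !quot_act_pi actM. Qed.

Fact quot_act_morph b : {morph quot_act b : x y / x * y}.
Proof.
move=> x y; rewrite -[x]quot_reprK -[y]quot_reprK.
by rewrite -quot_piM !quot_act_pi gactM quot_piM.
Qed.

Definition quot_action : group_action B (quot_group N) :=
  @GroupAction _ _ (Action quot_act1 quot_actM) quot_act_morph.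

End QuotientAction.

Section QuotientParabolicAction.
Variables (alpha beta : cosys) (eta : parabolic_action alpha beta).
Variable N : normal_subgroup (grp alpha).
Hypothesis etaN : forall b, pact eta b @` N = N.

Fact quot_pact_par b (i : typ (quot_cosys N)) :
  quot_action etaN b @` par i = par (tact eta b i : typ (quot_cosys N)).
Proof.
apply/seteqP; split=> [_ [_ [a ia <-] <-]|_ [a ia <-]].
  exists (pact eta b a); last exact/esym/quot_act_pi.
  by rewrite -pact_par; exists a.
move: ia; rewrite -pact_par => -[a' ia' <-].
by exists (quot_pi N a'); [exists a' | exact: quot_act_pi].
Qed.

Definition quot_parabolic_action : parabolic_action (quot_cosys N) beta :=
  @ParabolicAction (quot_cosys N) beta (quot_action etaN) (tact eta)
    quot_pact_par.

End QuotientParabolicAction.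

Lemma normal_closure_stable (B A : groupType) (eta : group_action B A)
    (M : set A) : (forall b, eta b @` M = M) ->
  forall b, eta b @` nclosure M = nclosure M.
Proof.
move=> etaM.
have sub b x : normal_closure M x -> normal_closure M (eta b x).
  move=> Mx H [[Hsg HJ] MH].
  apply: (Mx (eta b @^-1` H)); split; last first.
    by move=> y My; apply: MH; rewrite -(etaM b); exists y.
  split=> [|g y Hy]; first exact: gact_preimage.
  by rewrite /preimage /= !gactM gactV; apply: HJ.
move=> b; apply/seteqP; split=> [_ [x Mx <-]|x Mx]; first exact: sub.
by exists (eta b^-1 x); [apply: sub | rewrite -actM mulgV act1].
Qed.

Section Presentation.
Variables (S : choiceType).

(* [(s, true)] is the generator s and [(s, false)] is its formal inverse. *)
Definition word := seq (S * bool).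

Variable R : set word.

Inductive pres_eq : word -> word -> Prop :=
| pres_refl u : pres_eq u u
| pres_sym u v : pres_eq u v -> pres_eq v u
| pres_trans u v w : pres_eq u v -> pres_eq v w -> pres_eq u w
| pres_cat u u' v v' :
    pres_eq u u' -> pres_eq v v' -> pres_eq (u ++ v) (u' ++ v')
| pres_cancel s e : pres_eq [:: (s, e); (s, ~~ e)] [::]
| pres_relator r : R r -> pres_eq r [::].

Definition pres_rel (u v : word) : bool := `[< pres_eq u v >].

Fact pres_rel_refl : reflexive pres_rel.
Proof. by move=> u; apply/asboolP/pres_refl. Qed.

Fact pres_rel_sym : symmetric pres_rel.
Proof. by move=> u v; apply/asboolP/asboolP => /pres_sym. Qed.

Fact pres_rel_trans : transitive pres_rel.
Proof.
move=> v u w /asboolP uv /asboolP vw; apply/asboolP.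
exact: pres_trans uv vw.
Qed.

Canonical pres_equiv := EquivRel pres_rel pres_rel_refl pres_rel_sym
  pres_rel_trans.

Definition pres_group : Type := {eq_quot pres_equiv}.
HB.instance Definition _ := Choice.on pres_group.

Definition pres_pi (u : word) : pres_group := \pi_({eq_quot pres_equiv}) u.
Definition pres_repr (x : pres_group) : word :=
  repr (x : {eq_quot pres_equiv}).

Lemma pres_reprK : cancel pres_repr pres_pi.
Proof. exact: reprK. Qed.

Lemma pres_piP u v : pres_pi u = pres_pi v <-> pres_eq u v.
Proof. by split=> [/eqmodP/asboolP //|uv]; apply/eqmodP/asboolP. Qed.

Lemma pres_reprP u : pres_eq (pres_repr (pres_pi u)) u.
Proof. by apply/pres_piP; rewrite pres_reprK. Qed.

Definition word_inv (u : word) : word := rev [seq (l.1, ~~ l.2) | l <- u].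

Lemma word_invK : involutive word_inv.
Proof.
move=> u; rewrite /word_inv map_rev revK -map_comp -[RHS]map_id.
by apply: eq_map => -[s e] /=; rewrite negbK.
Qed.

Lemma word_inv_cat u v : word_inv (u ++ v) = word_inv v ++ word_inv u.
Proof. by rewrite /word_inv map_cat rev_cat. Qed.

Lemma pres_mulV u : pres_eq (word_inv u ++ u) [::].
Proof.
elim: u => [|[s e] u IHu]; first exact: pres_refl.
rewrite -cat1s word_inv_cat -catA; apply: pres_trans IHu.
apply: pres_cat (pres_refl _) _; rewrite catA -[X in pres_eq _ X]cat0s.
apply: pres_cat (pres_refl _).
by have := pres_cancel s (~~ e); rewrite negbK.
Qed.

Lemma pres_Vmul u : pres_eq (u ++ word_inv u) [::].
Proof. by rewrite -{1}[u]word_invK; apply: pres_mulV. Qed.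

Lemma pres_inv u v : pres_eq u v -> pres_eq (word_inv u) (word_inv v).
Proof.
move=> uv; apply: (@pres_trans _ (word_inv u ++ (v ++ word_inv v))).
  rewrite -[X in pres_eq X]cats0.
  exact/pres_cat/pres_sym/pres_Vmul/pres_refl.
rewrite catA -[X in pres_eq _ X]cat0s; apply: pres_cat (pres_refl _).
apply: pres_trans (pres_mulV u).
exact/pres_cat/pres_sym/uv/pres_refl.
Qed.

Definition pres_one : pres_group := pres_pi [::].
Definition pres_mul (x y : pres_group) :=
  pres_pi (pres_repr x ++ pres_repr y).
Definition pres_invg (x : pres_group) := pres_pi (word_inv (pres_repr x)).

Lemma pres_mul_pi u v : pres_mul (pres_pi u) (pres_pi v) = pres_pi (u ++ v).
Proof. by apply/pres_piP; apply: pres_cat; apply: pres_reprP. Qed.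

Lemma pres_inv_pi u : pres_invg (pres_pi u) = pres_pi (word_inv u).
Proof. by apply/pres_piP; apply: pres_inv; apply: pres_reprP. Qed.

Fact pres_group_mulA : associative pres_mul.
Proof.
move=> x y z; rewrite -[x]pres_reprK -[y]pres_reprK -[z]pres_reprK.
by rewrite !pres_mul_pi catA.
Qed.

Fact pres_group_mul1 : left_id pres_one pres_mul.
Proof. by move=> x; rewrite -[x]pres_reprK pres_mul_pi. Qed.

Fact pres_group_1mul : right_id pres_one pres_mul.
Proof. by move=> x; rewrite -[x]pres_reprK pres_mul_pi cats0. Qed.

Fact pres_group_mulV : left_inverse pres_one pres_invg pres_mul.
Proof.
move=> x; rewrite -[x]pres_reprK pres_inv_pi pres_mul_pi.
exact/pres_piP/pres_mulV.
Qed.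

Fact pres_group_Vmul : right_inverse pres_one pres_invg pres_mul.
Proof.
move=> x; rewrite -[x]pres_reprK pres_inv_pi pres_mul_pi.
exact/pres_piP/pres_Vmul.
Qed.

HB.instance Definition _ := isGroup.Build pres_group
  pres_group_mulA pres_group_mul1 pres_group_1mul pres_group_mulV
  pres_group_Vmul.

Lemma pres_piM u v : pres_pi (u ++ v) = pres_pi u * pres_pi v.
Proof. by rewrite -pres_mul_pi. Qed.

Definition pres_gen (s : S) : pres_group := pres_pi [:: (s, true)].

End Presentation.

(* [None] is the label ∞. *)
Definition label := option nat.

Definition label_ge (k : nat) (l : label) : bool :=
  if l is Some m then k <= m else true.

(* [lab s t] is only meaningful when s and t are adjacent. *)
Record coxgraph := CoxGraph {
  vert : choiceType;
  adj : vert -> vert -> Prop;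
  lab : vert -> vert -> label;
  adj_irr : forall s, ~ adj s s;
  adj_sym : forall s t, adj s t -> adj t s;
  lab_sym : forall s t, adj s t -> lab s t = lab t s;
  lab_ge3 : forall s t, adj s t -> label_ge 3 (lab s t) }.

(* Only used for distinct s and t. *)
Definition cox_m (K : coxgraph) (s t : vert K) : label :=
  if `[< adj s t >] then lab s t else Some 2.

Definition cox_relators (K : coxgraph) : set (word (vert K)) :=
  [set r | (exists s, r = [:: (s, true); (s, true)]) \/
           (exists s t m, [/\ s <> t, cox_m s t = Some m &
              r = flatten (nseq m [:: (s, true); (t, true)])])].

Definition cox_group (K : coxgraph) : groupType :=
  pres_group (@cox_relators K).

Definition cox_gen (K : coxgraph) (s : vert K) : cox_group K :=
  pres_gen (@cox_relators K) s.

Definition cox_parabolic (K : coxgraph) (s : vert K) :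
    subgroup (cox_group K) :=
  Subgroup (generated_subgroup [set cox_gen t | t in [set t | t <> s]]).

Definition cox_cosys (K : coxgraph) : cosys := {|
  grp := cox_group K;
  typ := vert K;
  par := @cox_parabolic K |}.

Record graph_action (B : groupType) (K : coxgraph) := GraphAction {
  gr_act :> action B (vert K);
  gr_act_adj : forall b s t, adj (gr_act b s) (gr_act b t) <-> adj s t;
  gr_act_lab : forall b s t, adj s t ->
    lab (gr_act b s) (gr_act b t) = lab s t }.

Section CoxeterAction.
Variables (B : groupType) (K : coxgraph) (f : graph_action B K).

Definition word_act (b : B) (u : word (vert K)) : word (vert K) :=
  [seq (f b l.1, l.2) | l <- u].

Lemma gr_act_inj b : injective (f b).
Proof.
by move=> s t eq_st; rewrite -[s](act1 f) -[t](act1 f) -(mulVg b) !actM eq_st.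
Qed.

Lemma cox_m_act b s t : cox_m (f b s) (f b t) = cox_m s t.
Proof.
rewrite /cox_m; case: asboolP => [/gr_act_adj st|nst].
  by rewrite asboolT // gr_act_lab.
by rewrite asboolF // => st; apply/nst/gr_act_adj.
Qed.

Lemma word_act_eq b u v : pres_eq (@cox_relators K) u v ->
  pres_eq (@cox_relators K) (word_act b u) (word_act b v).
Proof.
elim=> {u v} [u|u v _|u v w _ uv _ vw|u u' v v' _ uu' _ vv'|s e|r Rr].
- exact: pres_refl.
- exact: pres_sym.
- exact: pres_trans uv vw.
- by rewrite /word_act !map_cat; apply: pres_cat.
- exact: pres_cancel.
- apply: pres_relator; case: Rr => [[s ->]|[s [t [m [nst mst ->]]]]].
    by left; exists (f b s).
  right; exists (f b s), (f b t), m; split.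
  + by move/gr_act_inj.
  + by rewrite cox_m_act.
  + by rewrite /word_act map_flatten map_nseq.
Qed.

Definition cox_act (b : B) (x : cox_group K) : cox_group K :=
  pres_pi (@cox_relators K) (word_act b (pres_repr x)).

Lemma cox_act_pi b u : cox_act b (pres_pi (@cox_relators K) u) =
  pres_pi (@cox_relators K) (word_act b u).
Proof. by apply/pres_piP/word_act_eq/pres_reprP. Qed.

Lemma cox_act_gen b s : cox_act b (cox_gen s) = cox_gen (f b s).
Proof. exact: cox_act_pi. Qed.

Fact cox_act1 x : cox_act 1 x = x.
Proof.
rewrite -[x]pres_reprK cox_act_pi; congr pres_pi.
by rewrite -[RHS]map_id; apply: eq_map => -[s e] /=; rewrite act1.
Qed.

Fact cox_actM b c x : cox_act (b * c) x = cox_act b (cox_act c x).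
Proof.
rewrite -[x]pres_reprK !cox_act_pi; congr pres_pi.
by rewrite /word_act -map_comp; apply: eq_map => -[s e] /=; rewrite actM.
Qed.

Fact cox_act_morph b : {morph cox_act b : x y / x * y}.
Proof.
move=> x y; rewrite -[x]pres_reprK -[y]pres_reprK.
by rewrite -pres_piM !cox_act_pi /word_act map_cat pres_piM.
Qed.

Definition cox_action : group_action B (cox_group K) :=
  @GroupAction _ _ (Action cox_act1 cox_actM) cox_act_morph.

Lemma cox_act_parabolic b s x :
  (cox_parabolic s : set _) x ->
  (cox_parabolic (f b s) : set _) (cox_action b x).
Proof.
move=> xs H [Hsg SH].
apply: (xs (cox_action b @^-1` H)); split; first exact: gact_preimage.
move=> _ [t ts <-]; apply: SH; exists (f b t); last exact/esym/cox_act_gen.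
by move/gr_act_inj.
Qed.

End CoxeterAction.

Section CoxeterParabolicAction.
Variables (beta : cosys) (K : coxgraph) (f : graph_action (grp beta) K).

Fact cox_action_par b (s : typ (cox_cosys K)) :
  cox_action f b @` par s = par (f b s : typ (cox_cosys K)).
Proof.
apply/seteqP; split=> [_ [x xs <-]|x xs]; first exact: cox_act_parabolic.
have bK : f b^-1 (f b s) = s by rewrite -actM mulVg act1.
exists (cox_action f b^-1 x); last by rewrite -actM mulgV act1.
by have := @cox_act_parabolic _ _ f b^-1 _ _ xs; rewrite bK.
Qed.

Definition cox_parabolic_action : parabolic_action (cox_cosys K) beta :=
  @ParabolicAction (cox_cosys K) beta (cox_action f) f cox_action_par.

End CoxeterParabolicAction.

Section DiagonalGraph.
Variables (beta : cosys) (j : typ beta).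

Local Notation X := (coset_space (par j)).
Local Notation "b ⋅ F" := (coset_action (par j) b F) (at level 40).

(* The unordered pair {F1, F2} is the set [set F1; F2]. *)
Definition diag_class (F1 F2 : X) : set (set X) :=
  [set [set b ⋅ F1; b ⋅ F2] | b in [set: grp beta]].

Definition diag_classes : set (set (set X)) :=
  [set c | exists F1 F2, F1 <> F2 /\ c = diag_class F1 F2].

(* Values outside [diag_classes] are irrelevant. *)
Record diag_label := DiagLabel {
  lam :> set (set X) -> label;
  lam_ge2 : forall c, diag_classes c -> label_ge 2 (lam c) }.

Variable lambda : diag_label.

Definition diag_adj (F1 F2 : X) : Prop :=
  F1 <> F2 /\ lambda (diag_class F1 F2) <> Some 2.

Definition diag_lab (F1 F2 : X) : label := lambda (diag_class F1 F2).

Lemma diag_classC F1 F2 : diag_class F1 F2 = diag_class F2 F1.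
Proof. by apply: eq_imagel => b _; rewrite setUC. Qed.

Lemma diag_class_act b F1 F2 :
  diag_class (b ⋅ F1) (b ⋅ F2) = diag_class F1 F2.
Proof.
apply/seteqP; split=> [_ [c _ <-]|_ [c _ <-]].
  by exists (c * b) => //; rewrite !actM.
by exists (c * b^-1) => //; rewrite -!actM mulgVK.
Qed.

Fact diag_adj_irr F : ~ diag_adj F F.
Proof. by case. Qed.

Fact diag_adj_sym F1 F2 : diag_adj F1 F2 -> diag_adj F2 F1.
Proof.
by move=> [n12 l12]; split; [exact/nesym | rewrite diag_classC].
Qed.

Fact diag_lab_sym F1 F2 : diag_adj F1 F2 -> diag_lab F1 F2 = diag_lab F2 F1.
Proof. by rewrite /diag_lab diag_classC. Qed.

Fact diag_lab_ge3 F1 F2 : diag_adj F1 F2 -> label_ge 3 (diag_lab F1 F2).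
Proof.
move=> [n12]; rewrite /diag_lab.
have : label_ge 2 (lambda (diag_class F1 F2)).
  by apply: lam_ge2; exists F1, F2.
by case: (lam _ _) => [[|[|[]]]|].
Qed.

Definition diag_graph : coxgraph := {|
  vert := X;
  adj := diag_adj;
  lab := diag_lab;
  adj_irr := diag_adj_irr;
  adj_sym := diag_adj_sym;
  lab_sym := diag_lab_sym;
  lab_ge3 := diag_lab_ge3 |}.

End DiagonalGraph.

Section Extension.
Variables (G : coxgraph) (v : vert G) (D : coxgraph).

(* The distinguished vertex of D represents the identified vertex. An edge
   between a vertex w <> v of G and the identified vertex is an edge of G; the
   added edges join w to the other vertices of D under the same condition and
   with the same label, so the distinguished vertex of D does not occur in the
   definition. *)
Definition ext_vert : choiceType := ({w : vert G | w != v} + vert D)%type.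

Definition ext_adj (s t : ext_vert) : Prop :=
  match s, t with
  | inl w, inl w' => adj (val w) (val w')
  | inl w, inr _ | inr _, inl w => adj (val w) v
  | inr x, inr x' => adj x x'
  end.

Definition ext_lab (s t : ext_vert) : label :=
  match s, t with
  | inl w, inl w' => lab (val w) (val w')
  | inl w, inr _ | inr _, inl w => lab (val w) v
  | inr x, inr x' => lab x x'
  end.

Fact ext_adj_irr s : ~ ext_adj s s.
Proof. by case: s => s; apply: adj_irr. Qed.

Fact ext_adj_sym s t : ext_adj s t -> ext_adj t s.
Proof. by case: s t => [s|s] [t|t] //=; apply: adj_sym. Qed.

Fact ext_lab_sym s t : ext_adj s t -> ext_lab s t = ext_lab t s.
Proof. by case: s t => [s|s] [t|t] //=; apply: lab_sym. Qed.

Fact ext_lab_ge3 s t : ext_adj s t -> label_ge 3 (ext_lab s t).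
Proof. by case: s t => [s|s] [t|t] //=; apply: lab_ge3. Qed.

Definition ext_graph : coxgraph := {|
  vert := ext_vert;
  adj := ext_adj;
  lab := ext_lab;
  adj_irr := ext_adj_irr;
  adj_sym := ext_adj_sym;
  lab_sym := ext_lab_sym;
  lab_ge3 := ext_lab_ge3 |}.

End Extension.

Section DiagonalExtension.
Variables (beta : cosys) (j : typ beta) (lambda : diag_label j).
Variables (G : coxgraph) (v : vert G).

Definition diag_ext : coxgraph := ext_graph v (diag_graph lambda).

Definition diag_ext_act (b : grp beta) (s : vert diag_ext) : vert diag_ext :=
  match s with
  | inl w => inl w
  | inr x => inr (coset_action (par j) b x)
  end.

Fact diag_ext_act1 s : diag_ext_act 1 s = s.
Proof. by case: s => //= x; rewrite coset_translate1. Qed.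

Fact diag_ext_actM b c s :
  diag_ext_act (b * c) s = diag_ext_act b (diag_ext_act c s).
Proof. by case: s => //= x; rewrite coset_translateM. Qed.

Definition diag_ext_vaction : action (grp beta) (vert diag_ext) :=
  Action diag_ext_act1 diag_ext_actM.

Fact diag_ext_act_adj b (s t : vert diag_ext) :
  adj (diag_ext_vaction b s) (diag_ext_vaction b t) <-> adj s t.
Proof.
case: s t => [s|s] [t|t] //=; rewrite /diag_adj diag_class_act.
split=> -[nst lst]; split=> // eq_st; apply: nst; first by rewrite eq_st.
have bK x : coset_translate b^-1 (coset_translate b x) = x.
  by rewrite -coset_translateM mulVg coset_translate1.
by rewrite -[s]bK -[t]bK; congr coset_translate.
Qed.

Fact diag_ext_act_lab b (s t : vert diag_ext) : adj s t ->
  lab (diag_ext_vaction b s) (diag_ext_vaction b t) = lab s t.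
Proof.
by case: s t => [s|s] [t|t] //= _; rewrite /diag_lab diag_class_act.
Qed.

Definition diag_ext_gaction : graph_action (grp beta) diag_ext :=
  GraphAction diag_ext_act_adj diag_ext_act_lab.

Definition diag_ext_action : parabolic_action (cox_cosys diag_ext) beta :=
  cox_parabolic_action diag_ext_gaction.

Definition diag_base : vert diag_ext := inr (base_coset (par j)).

Definition diag_orbit : set (vert diag_ext) :=
  [set inr x | x in [set: coset_space (par j)]].

End DiagonalExtension.

Arguments diag_base {beta j} lambda {G} v.
Arguments diag_orbit {beta j} lambda {G} v.

(* Main.v *)
Require Import Defs.
From Stdlib Require Import Relation_Operators.
From mathcomp Require Import all_boot monoid.
From mathcomp Require Import ssralg ssrnum poly algC cyclotomic ring.
From mathcomp Require Import boolp classical_sets functions cardinality.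

Set Implicit Arguments.
Unset Strict Implicit.
Unset Printing Implicit Defensive.

Local Open Scope classical_set_scope.
Local Open Scope group_scope.

(** A coset incidence system can be tested entirely inside its group
    ([regular_hypertopeP]). Flag-transitivity says that cosets of maximal
    parabolics which meet pairwise have a common element ([helly]); every flag
    is then a translate of a set of maximal parabolics, and residues are again
    coset systems, of the intersections B_J. Thinness becomes an index-two
    condition, residual connectedness the generation of each B_J by the
    subgroups one step below it, and faithfulness the triviality of the core.

    These four conditions pass from alpha and beta to the semidirect product
    ([twisting_regular_hypertope]). A family of pairwise meeting cosets of
    A x| B is straightened by a common element of its B-parts; the A-parts are
    then cosets of intersections of maximal parabolics of alpha, and refine to
    a flag of alpha. For generation, the subgroup generated one step below the
    intersection over J contains B_S, S being the base types in J, and also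
    A_(V - F_L) for each orbit L outside J, together with its conjugates by B_S.
    The types needed in L are those lying in B_i . F_L for all i in S, and they
    have to be exactly B_S . F_L. This is a form of admissibility for
    arbitrary sets of types ([orbits_helly]). It holds as soon as the
    stabiliser in B of each representative is B or one of the B_j, for then it
    is an instance of flag-transitivity of beta. In the diagonal extension the
    representatives are the vertices fixed by B and the coset B_j.

    It remains to see that a Coxeter group of finite rank is a regular
    hypertope. Two facts carry this. A generator does not lie in the subgroup
    generated by the others: in the dual of the reflection representation those
    others fix a functional that the generator moves
    ([cox_gen_notin_others]). And a word which is not reduced can be shortened
    by deleting two letters: how often, modulo 2, a given element occurs among
    the reflections of a word depends only on the product of the word
    ([reflection_parity]). Together they show that all letters of a reduced
    word lie in X whenever its product lies in the parabolic subgroup W_X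
    ([standard_parabolic_reduced]). Hence the W_X are closed under
    intersection and satisfy
    W_X n (W_Y W_Z) = (W_X n W_Y) (W_X n W_Z), from which the common element of
    pairwise meeting cosets is built one coset at a time ([cox_helly]). *)

(** * Regular hypertopes in terms of cosets *)

Section Cosets.
Variable G : groupType.
Implicit Types (H S : set G) (g h x : G).

Lemma sub_generated S : S `<=` generated S.
Proof. exact: sub_gen_smallest. Qed.

Lemma generated_min S H : is_subgroup H -> S `<=` H -> generated S `<=` H.
Proof. exact: smallest_sub. Qed.

Lemma lcosetE H g x : lcoset g H x <-> H (g^-1 * x).
Proof.
split=> [[y Hy <-]|Hx]; first by rewrite mulKg.
by exists (g^-1 * x); rewrite ?mulVKg.
Qed.

Lemma lcoset_refl H g : is_subgroup H -> lcoset g H g.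
Proof. by move=> [H1 _ _]; apply/lcosetE; rewrite mulVg. Qed.

Lemma lcoset_eqP H g h :
  is_subgroup H -> lcoset g H = lcoset h H <-> H (g^-1 * h).
Proof.
move=> [H1 HM HV]; split=> [eq_gh|Hgh].
  by apply/lcosetE; rewrite eq_gh; apply/lcosetE; rewrite mulVg.
apply/seteqP; split=> x /lcosetE Hx; apply/lcosetE.
  have := HM _ _ (HV _ Hgh) Hx; rewrite invgM invgK -mulgA.
  by rewrite mulVKg.
by have := HM _ _ Hgh Hx; rewrite -mulgA mulVKg.
Qed.

Lemma lcoset_meet H g h : is_subgroup H ->
  lcoset g H `&` lcoset h H !=set0 -> lcoset g H = lcoset h H.
Proof.
move=> Hsg [x [/lcosetE gx /lcosetE hx]]; apply/lcoset_eqP => //.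
have [_ HM HV] := Hsg; have := HM _ _ gx (HV _ hx).
by rewrite invgM invgK mulgA mulgK.
Qed.

End Cosets.

Section CosetGeometry.
Variable beta : cosys.

Local Notation B := (grp beta).
Local Notation I := (typ beta).

Definition std_flag (J : set I) (g : B) : set (I * set B) :=
  [set (i, lcoset g (par i)) | i in J].

(** The name is by analogy with the Helly property of families of sets. *)
Definition helly : Prop := forall (J : set I) (g : I -> B),
  (forall i k, J i -> J k ->
     lcoset (g i) (par i) `&` lcoset (g k) (par k) !=set0) ->
  exists x, forall i, J i -> sg_set (par i) ((g i)^-1 * x).

(** The intersection of all [par k] with [k] different from [i] is the
    stabiliser of a flag of corank one; it meets [par i] in a subgroup of
    index two. *)
Definition coset_thin : Prop := forall i : I, exists s,
  [/\ parJ (~` [set i]) s, ~ sg_set (par i) s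
    & forall x, parJ (~` [set i]) x ->
        sg_set (par i) x \/ sg_set (par i) (s^-1 * x)].

Definition coset_generated : Prop := forall J : set I,
  (exists i k, [/\ i <> k, ~ J i & ~ J k]) ->
  parJ J `<=` generated (\bigcup_(i in ~` J) parJ (i |` J)).

Definition coset_faithful : Prop := forall b : B,
  (forall (i : I) g, sg_set (par i) (g^-1 * b * g)) -> b = 1.

Lemma par1 (i : I) : sg_set (par i) 1.
Proof. by case: (sgP (par i)). Qed.

Lemma parM (i : I) x y :
  sg_set (par i) x -> sg_set (par i) y -> sg_set (par i) (x * y).
Proof. by case: (sgP (par i)) => _ + _; apply. Qed.

Lemma parV (i : I) x : sg_set (par i) x -> sg_set (par i) x^-1.
Proof. by case: (sgP (par i)) => _ _; apply. Qed.

Lemma std_flag_type J g : type_set (std_flag J g) = J.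
Proof.
apply/seteqP; split=> [_ [_ [i Ji <-] <-] //|i Ji].
by exists (i, lcoset g (par i)); first exists i.
Qed.

Lemma std_flag_flag J g : flag (std_flag J g).
Proof.
split=> [_ [i _ <-]|_ _ [i _ <-] [k _ <-]]; first by exists g.
by exists g; split; apply/lcoset_refl/sgP.
Qed.

Lemma translate_std_flag J b g :
  translate b @` std_flag J g = std_flag J (b * g).
Proof.
apply/seteqP; split=> [_ [_ [i Ji <-] <-]|_ [i Ji <-]].
  by exists i; rewrite // lcosetM.
exists (i, lcoset g (par i)); first by exists i.
by rewrite /translate /= lcosetM.
Qed.

Lemma flag_rep F : flag F ->
  exists g : I -> B, forall i X, F (i, X) -> X = lcoset (g i) (par i).
Proof.
move=> [Fel Finc].
have /choice [g gP] : forall i, exists g, forall X, F (i, X) ->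
    X = lcoset g (par i).
  move=> i; have [[X FX]|nX] := pselect (exists X, F (i, X)); last first.
    by exists 1 => X FX; case: nX; exists X.
  have [/= g eqX] := Fel _ FX; exists g => Y FY.
  have [h /= eqY] := Fel _ FY; rewrite eqX in FX; rewrite eqY in FY *.
  exact/esym/(lcoset_meet (sgP _))/(Finc _ _ FX FY).
by exists g.
Qed.

(** A common element of the members of a flag represents all of them. *)
Lemma helly_flag F : helly -> flag F ->
  exists g, F = std_flag (type_set F) g.
Proof.
move=> hB Fflag; have [g gP] := flag_rep Fflag; case: Fflag => Fel Finc.
have FE i : type_set F i -> F (i, lcoset (g i) (par i)).
  by case=> -[k X] FX /= <-; rewrite -(gP k X FX).
have [|x xP] := hB (type_set F) g.
  by move=> i k Fi Fk; apply: (Finc _ _ (FE i Fi) (FE k Fk)).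
have gx i : type_set F i -> lcoset x (par i) = lcoset (g i) (par i).
  by move=> Fi; apply/esym/lcoset_eqP; [apply: sgP | apply: xP].
exists x; apply/seteqP; split=> [[i X] FX|_ [i Fi <-]]; last first.
  by rewrite gx //; apply: FE.
have Fi : type_set F i by exists (i, X).
by exists i => //; rewrite gx // (gP _ _ FX).
Qed.

(** A family of pairwise meeting cosets is a flag, and the maximal parabolics
    of the same types form another; an element which moves the second onto the
    first is common to all the cosets. *)
Lemma hellyP : flag_transitive beta <-> helly.
Proof.
split=> [FT J g gJ|hB F F' Ff Ff' eqT]; last first.
  have [g ->] := helly_flag hB Ff; have [h ->] := helly_flag hB Ff'.
  by exists (h * g^-1); rewrite translate_std_flag mulgVK eqT.
pose F := [set (i, lcoset (g i) (par i)) | i in J].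
have [|||b bP] := FT (std_flag J 1) F; first exact: std_flag_flag.
- split=> [_ [i _ <-]|_ _ [i Ji <-] [k Jk <-]]; first by exists (g i).
  exact: gJ.
- rewrite std_flag_type; apply/seteqP; split=> [i Ji|_ [_ [i Ji <-] <-] //].
  by exists (i, lcoset (g i) (par i)); first exists i.
exists b => i Ji; rewrite translate_std_flag mulg1 in bP.
have : F (i, lcoset b (par i)) by rewrite -bP; exists i.
by case=> _ _ [-> /(lcoset_eqP _ _ (sgP _))].
Qed.

Lemma helly_geometry : helly -> incidence_geometry beta.
Proof.
move=> hB F [Ff Fmax]; split=> //; have [g eqF] := helly_flag hB Ff.
rewrite -[F](Fmax (std_flag setT g)) ?std_flag_type //.
- exact: std_flag_flag.
- by rewrite eqF => _ [i _ <-]; exists i.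
Qed.

(** A coset incident to all members of a standard flag shares an element with
    all of them at once. This identifies the residue with a translate of the
    coset system of [parJ J]. *)
Lemma residue_std J g k X : helly ->
  residue (std_flag J g) (k, X) <->
  ~ J k /\ exists2 h, parJ J h & X = lcoset (g * h) (par k).
Proof.
move=> hB; split=> [[[x /= ->] nFk Fk]|[nJk [h hJ ->]]]; last first.
  split=> [||_ [i Ji <-]]; first by exists (g * h).
    by case=> i Ji [eqik _]; apply: nJk; rewrite -eqik.
  exists (g * h); split; first exact/lcoset_refl/sgP.
  by apply/lcosetE; rewrite mulKg; apply: hJ.
have nJk : ~ J k.
  move=> Jk; apply: nFk; exists k => //; congr (_, _).
  apply/esym/(lcoset_meet (sgP _)); apply: (Fk (k, lcoset g (par k))).
  by exists k.
split=> //.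
have [|y yP] := hB (k |` J) (fun i => if `[< i = k >] then x else g).
  have xg i : J i -> lcoset x (par k) `&` lcoset g (par i) !=set0.
    by move=> Ji; apply: (Fk (i, lcoset g (par i))); exists i.
  have nJ i : J i -> `[< i = k >] = false.
    by move=> Ji; apply/asboolP => eqik; apply: nJk; rewrite -eqik.
  move=> i l [->|Ji] [->|Jl]; rewrite ?(asboolT (erefl k)) ?nJ //.
  - by exists x; split; apply/lcoset_refl/sgP.
  - exact: xg.
  - by rewrite setIC; apply: xg.
  - by exists g; split; apply/lcoset_refl/sgP.
exists (g^-1 * y).
  move=> i Ji; have := yP i (or_intror Ji).
  by case: asboolP => // eqik; case: nJk; rewrite -eqik.
rewrite mulVKg; apply/lcoset_eqP; first exact: sgP.
by have := yP k (or_introl erefl); rewrite asboolT.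
Qed.

Lemma setC1_type (J : set I) i : ~` J = [set i] -> J = ~` [set i].
Proof. by move=> <-; rewrite setCK. Qed.

Lemma thinP : helly -> thin beta <-> coset_thin.
Proof.
move=> hB; split=> [th i|th F Ff [i /setC1_type FJ]]; last first.
  have [g] := helly_flag hB Ff; rewrite {}FJ => {F Ff}->.
  have [s [sJ nsi sP]] := th i.
  exists (i, lcoset g (par i)), (i, lcoset (g * s) (par i)); split.
    by case=> /(lcoset_eqP _ _ (sgP _)); rewrite mulKg.
  apply/seteqP; split=> [[k X] /(residue_std _ _ _ _ hB)|x].
    move=> [/= nki [h hJ ->]]; have {nki}-> : k = i by apply: contrapT.
    have [hi|hi] := sP h hJ; [left|right]; congr (_, _).
      by apply/esym/lcoset_eqP; [exact: sgP | rewrite mulKg].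
    by apply/esym/lcoset_eqP; [exact: sgP | rewrite invgM -mulgA mulKg].
  case=> ->; apply/(residue_std _ _ _ _ hB); split; try by apply.
    by exists 1; [case: (parJ_subgroup (~` [set i])) | rewrite mulg1].
  by exists s.
have [||x [y [nxy resE]]] := th (std_flag (~` [set i]) 1).
- exact: std_flag_flag.
- by exists i; rewrite std_flag_type setCK.
have resP h : parJ (~` [set i]) h ->
    residue (std_flag (~` [set i]) 1) (i, lcoset h (par i)).
  move=> hJ; apply/(residue_std _ _ _ _ hB); split; first by apply.
  by exists h; rewrite ?mul1g.
have repP z : residue (std_flag (~` [set i]) 1) z ->
    exists2 h, parJ (~` [set i]) h & z = (i, lcoset h (par i)).
  case: z => k X /(residue_std _ _ _ _ hB) [nki [h hJ ->]].
  have -> : k = i by apply: contrapT.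
  by exists h; rewrite ?mul1g.
have [_ pM pV] := parJ_subgroup (~` [set i]).
have [hx hxJ eqx] : exists2 h, parJ (~` [set i]) h & x = (i, lcoset h (par i)).
  by apply: repP; rewrite resE; left.
have [hy hyJ eqy] : exists2 h, parJ (~` [set i]) h & y = (i, lcoset h (par i)).
  by apply: repP; rewrite resE; right.
have two h : parJ (~` [set i]) h ->
    sg_set (par i) (hx^-1 * h) \/ sg_set (par i) (hy^-1 * h).
  move=> /resP; rewrite resE eqx eqy => -[] [] /esym/lcoset_eqP hP.
    by left; apply: hP (sgP _).
  by right; apply: hP (sgP _).
exists (hx^-1 * hy); split.
- by apply: pM => //; apply: pV.
- move=> /lcoset_eqP eqxy; apply: nxy; rewrite eqx eqy; congr (_, _).
  exact/eqxy/sgP.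
move=> h hJ; have [] := two (hx * h) (pM _ _ hxJ hJ).
  by rewrite mulKg; left.
by rewrite invgM invgK -mulgA; right.
Qed.

(** Along a path of incident cosets in the residue of a standard flag, a
    representative can be chosen inside the subgroup generated by the
    [parJ (i |` J)]: two consecutive cosets share an element with the flag, and
    this element differs from the previous representative by a member of one of
    the generating subgroups. *)
Lemma connected_generated : helly ->
  residually_connected beta -> coset_generated.
Proof.
move=> hB rc J cork g gJ; have [i [_ [_ nJi _]]] := cork.
pose H := generated (\bigcup_(i in ~` J) parJ (i |` J)).
have [H1 HM HV] : is_subgroup H by apply: generated_subgroup.
have parH l x : ~ J l -> parJ (l |` J) x -> H x.
  by move=> nJl xlJ; apply: sub_generated; exists l.
have [pJ1 pJM pJV] := parJ_subgroup J.
have HJ x : H x -> parJ J x.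
  apply: generated_min; first exact: parJ_subgroup.
  by move=> y [l _ yl] m Jm; apply: yl; right.
have res h : parJ J h -> residue (std_flag J 1) (i, lcoset h (par i)).
  move=> hJ; apply/(residue_std _ _ _ _ hB); split=> //.
  by exists h; rewrite ?mul1g.
pose inv (z : I * set B) := exists2 h, H h & z.2 = lcoset h (par z.1).
have step z z' : [/\ residue (std_flag J 1) z, residue (std_flag J 1) z'
                  & incident z z'] -> inv z -> inv z'.
  case: z z' => [l X] [m Y] [/(residue_std _ _ _ _ hB) [nJl _]].
  move=> /(residue_std _ _ _ _ hB) [nJm [k kJ eqY]] inc [h Hh /= eqX].
  rewrite mul1g in eqY; rewrite eqX {X eqX} in inc.
  have [eqml|nml] := pselect (m = l).
    exists h => //=; rewrite eqY in inc *; rewrite {}eqml {m nJm Y eqY} in inc *.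
    exact/esym/(lcoset_meet (sgP _)).
  (* Adding the current coset to the flag puts the next one into a residue of
     smaller rank, whose representatives are known. *)
  have : residue (std_flag (l |` J) h) (m, Y).
    split; first by exists k.
      by move=> [n + [eqn _]]; rewrite eqn => -[/nml|/nJm].
    move=> _ [n [->|Jn] <-]; first by rewrite /incident setIC.
    exists k; rewrite eqY; split; first exact/lcoset_refl/sgP.
    by apply/lcosetE/parM; [apply: parV; apply: (HJ h) | apply: kJ].
  move=> /(residue_std _ _ _ _ hB) [_ [h' h'lJ ->]]; exists (h * h') => //.
  by apply: HM => //; apply: parH h'lJ.
have path : clos_refl_trans _ (fun u w => [/\ residue (std_flag J 1) u,
    residue (std_flag J 1) w & incident u w])
    (i, lcoset 1 (par i)) (i, lcoset g (par i)).
  apply: rc; rewrite ?std_flag_type; first exact: std_flag_flag.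
  - exact: cork.
  - exact: res.
  - exact: res.
have [h Hh /= /esym/(lcoset_eqP _ _ (sgP _)) hg] : inv (i, lcoset g (par i)).
  have : inv (i, lcoset 1 (par i)) by exists 1.
  by elim: path => [z z' /step //|//|z z1 z2 _ IH1 _ IH2 /IH1/IH2].
rewrite -[g](mulVKg h); apply: HM => //; apply: (parH i) => // m [->//|Jm].
by apply: parM; [apply: parV; apply: (HJ h) | apply: gJ].
Qed.

(** Each generating subgroup [parJ (k |` J)] preserves the connected component
    of the coset of type [i], by passing through the coset of type [k] that it
    fixes; hence so does [parJ J]. *)
Lemma generated_connected : helly ->
  coset_generated -> residually_connected beta.
Proof.
move=> hB gen F Ff cork; have [g eqF] := helly_flag hB Ff.
have genF := gen _ cork; case: cork => i [_ [_ nJi _]].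
move: (type_set F) eqF genF nJi => J -> {}gen nJi.
set S := residue _.
pose conn := clos_refl_trans _ (fun u w => [/\ S u, S w & incident u w]).
have inS k h : ~ J k -> parJ J h -> S (k, lcoset (g * h) (par k)).
  by move=> nJk hJ; apply/(residue_std _ _ _ _ hB); split=> //; exists h.
have same k l h : ~ J k -> ~ J l -> parJ J h ->
    conn (k, lcoset (g * h) (par k)) (l, lcoset (g * h) (par l)).
  move=> nJk nJl hJ; apply: rt_step; split; try exact: inS.
  by exists (g * h); split; apply/lcoset_refl/sgP.
have conn_sym u w : conn u w -> conn w u.
  elim=> [x y [Sx Sy xy]|x|x y z _ IHxy _ IHyz]; [apply: rt_step|exact: rt_refl|].
    by split=> //; move: xy; rewrite /incident setIC.
  exact: rt_trans IHyz IHxy.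
have [pJ1 pJM pJV] := parJ_subgroup J.
(* Quantifying over all translates makes the set of elements that preserve
   components a subgroup. *)
pose H := [set h | parJ J h /\ forall x, parJ J x ->
  conn (i, lcoset (g * x) (par i)) (i, lcoset (g * (x * h)) (par i))].
have all_conn h : parJ J h ->
    conn (i, lcoset (g * 1) (par i)) (i, lcoset (g * h) (par i)).
  move=> /gen/(_ H) hH; suff: H h by case=> _ /(_ 1 pJ1); rewrite mul1g.
  apply: hH; split=> [|p [k nJk pk]].
    split=> [|h1 h2 [h1J c1] [h2J c2]|h1 [h1J c1]]; split.
    - exact: pJ1.
    - by move=> x xJ; rewrite mulg1; apply: rt_refl.
    - exact: pJM.
    - move=> x xJ; apply: rt_trans (c1 x xJ) _; rewrite (mulgA x); apply: c2.
      exact: pJM.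
    - exact: pJV.
    - move=> x xJ; apply: conn_sym.
      have {2}-> : x = x * h1^-1 * h1 by rewrite mulgVK.
      by apply: c1; apply: pJM => //; apply: pJV.
  have pJ : parJ J p by move=> m Jm; apply: pk; right.
  split=> // x xJ; apply: rt_trans (same i k x nJi nJk xJ) _.
  have -> : lcoset (g * x) (par k) = lcoset (g * (x * p)) (par k).
    apply/lcoset_eqP; first exact: sgP.
    by rewrite (mulgA g) mulKg; apply: pk; left.
  by apply: same => //; apply: pJM.
have to_base z : S z -> conn (i, lcoset (g * 1) (par i)) z.
  case: z => k X /(residue_std _ _ _ _ hB) [nJk [h hJ ->]].
  exact: rt_trans (all_conn h hJ) (same _ _ _ nJi nJk hJ).
by move=> z z' Sz Sz'; apply: rt_trans (to_base z' Sz'); apply/conn_sym/to_base.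
Qed.

Lemma faithfulP : faithful beta <-> coset_faithful.
Proof.
split=> fth b bP; apply: fth.
  move=> [i _] [g /= ->]; rewrite /translate /= -lcosetM; congr (_, _).
  apply/esym/lcoset_eqP; first exact: sgP.
  by rewrite mulgA.
move=> i g; have [] : translate b (i, lcoset g (par i)) = (i, lcoset g (par i)).
  by apply: bP; exists g.
rewrite -lcosetM => /esym/(lcoset_eqP _ _ (sgP _)).
by rewrite mulgA.
Qed.

Theorem regular_hypertopeP : regular_hypertope beta <->
  [/\ helly, coset_thin, coset_generated & coset_faithful].
Proof.
split=> [[_ th rc ff /hellyP hB]|[hB th rc ff]].
  split=> //; [exact/thinP | exact: connected_generated | exact/faithfulP].
split; first exact: helly_geometry.
- exact/thinP.
- exact: generated_connected.
- exact/faithfulP.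
- exact/hellyP.
Qed.

End CosetGeometry.

(** * Twistings of regular hypertopes *)

(** Iterating [coset_generated] reaches the subgroups of corank one because
    only finitely many types lie outside [J]. *)
Lemma parJ_generated_corank1 (alpha : cosys) (J : set (typ alpha)) :
  finite_set [set: typ alpha] -> coset_generated alpha -> (exists x, ~ J x) ->
  parJ J `<=` generated (\bigcup_(x in ~` J) parJ (~` [set x])).
Proof.
move=> finV gen.
have [s sP] : exists s : seq {classic (typ alpha)}, forall x, x \in s.
  have /finite_seqP [s sE] : finite_set [set: {classic (typ alpha)}] := finV.
  by exists s => x; have : [set` s] x by rewrite -sE.
have {sP} : forall x : {classic (typ alpha)}, ~ J x -> x \in s by [].
have [n] := ubnP (size s); elim: n s J => // n IHn s J sn Js [x nJx].
have [only|] := pselect (forall y, ~ J y -> y = x).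
  move=> a aJ; apply: sub_generated; exists x => // y /= nyx.
  by apply: aJ; apply: contrapT => /only.
move=> /existsNP [y /not_implyP [nJy nyx]] a aJ.
have := gen J (ex_intro _ x (ex_intro _ y (And3 (nesym nyx) nJx nJy))) a aJ.
apply: generated_min; first exact: generated_subgroup.
move=> b [z nJz bz].
(* Some type must be left outside [z |` J] for the induction to apply. *)
have [w [nJw nwz]] : exists w, ~ J w /\ w <> z.
  have [<-|nzx] := pselect (x = z); first by exists y.
  by exists x.
pose s' := [seq t : {classic (typ alpha)} <- s | t != z].
have /IHn IH : (size s' < n)%N.
  rewrite -ltnS; apply: leq_trans sn; rewrite ltnS size_filter.
  rewrite -[ltnRHS](count_predC (pred1 (z : {classic (typ alpha)}))).
  rewrite -add1n leq_add2r.
  by rewrite -has_count; apply/hasP; exists z; [apply: Js|rewrite /= eqxx].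
have sub : generated (\bigcup_(x in ~` (z |` J)) parJ (~` [set x])) `<=`
    generated (\bigcup_(x in ~` J) parJ (~` [set x])).
  apply: generated_min; first exact: generated_subgroup.
  move=> c [u nJu cu]; apply: sub_generated; exists u => // Ju.
  by apply: nJu; right.
apply: sub; apply: (IH (z |` J)) bz; last first.
  by exists w; case.
move=> t nJt; rewrite mem_filter Js ?andbT; last by move=> Jt; apply: nJt; right.
by apply/eqP => eqtz; apply: nJt; left.
Qed.

Section Twisting.
Variables (alpha beta : cosys) (eta : parabolic_action alpha beta).
Variable F : orbit_choice eta.

Local Notation A := (grp alpha).
Local Notation B := (grp beta).
Local Notation V := (typ alpha).
Local Notation G := (sdprod (pact eta)).
Local Notation tau := (twisting F).

Lemma orbit_inj (L L' : orbits eta) x : val L x -> val L' x -> L = L'.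
Proof.
have sub (M M' : orbits eta) : val M x -> val M' x -> val M `<=` val M'.
  case: M => M MP /= Mx M'x y My; have [k /= Mk] := set_mem MP.
  move: Mx My M'x; rewrite {}Mk => -[c _ <-] [d _ <-] M'c.
  by have := orbit_act (d * c^-1) M'c; rewrite -actM mulgVK.
by move=> Lx L'x; apply/val_inj/seteqP; split; apply: sub.
Qed.

Lemma orbit_ex (x : V) : exists L : orbits eta, val L x.
Proof.
have LP : type_orbit eta x \in [set L | exists i, L = type_orbit eta i].
  by apply/mem_set; exists x.
by exists (exist (fun L => is_true (L \in _)) _ LP); exists 1; rewrite // act1.
Qed.

Lemma par_orbit_rep (L : orbits eta) i : par_orbit F L i (F L).
Proof. by exists 1; [apply: par1 | rewrite act1]. Qed.

Lemma pact_parJ_setC1 b x a :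
  parJ (~` [set x]) a -> parJ (~` [set tact eta b x]) (pact eta b a).
Proof.
move=> ax y /= nxy; have ya : sg_set (par (tact eta b^-1 y)) a.
  by apply: ax => /= eqx; apply: nxy; rewrite -eqx -actM mulgV act1.
have := pact_par eta b (tact eta b^-1 y).
by rewrite -actM mulgV act1 => <-; exists a.
Qed.

Definition inA (a : A) : G := (a, 1).
Definition inB (b : B) : G := (1, b).

Lemma sdM (x y : G) : x * y = (x.1 * pact eta x.2 y.1, x.2 * y.2).
Proof. by []. Qed.

Lemma sdV (x : G) : x^-1 = (pact eta x.2^-1 x.1^-1, x.2^-1).
Proof. by []. Qed.

Lemma inAM a a' : inA (a * a') = inA a * inA a'.
Proof. by rewrite sdM /= act1 mulg1. Qed.

Lemma inBM b b' : inB (b * b') = inB b * inB b'.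
Proof. by rewrite sdM /= gact1 mulg1. Qed.

Lemma inAV a : inA a^-1 = (inA a)^-1.
Proof. by rewrite sdV /= invg1 act1. Qed.

Lemma inBV b : inB b^-1 = (inB b)^-1.
Proof. by rewrite sdV /= invg1 gact1. Qed.

Lemma sdprodE (x : G) : x = inA x.1 * inB x.2.
Proof. by case: x => a b; rewrite sdM /= gact1 mulg1 mul1g. Qed.

Lemma inA_conj a b : inB b * inA a * inB b^-1 = inA (pact eta b a).
Proof. by rewrite !sdM /= mulg1 mul1g gact1 mulg1 mulgV. Qed.

(** The two kinds of maximal parabolics of the twisting have the common form
    of the semidirect product of [parJ (cut_types t)] and [base_group t]. *)
Definition cut_types (t : typ tau) : set V :=
  match t with
  | inl i => \bigcup_(L : orbits eta) (val L `\` par_orbit F L i)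
  | inr L => val L
  end.

Definition base_group (t : typ tau) : set B :=
  match t with inl i => sg_set (par i) | inr _ => setT end.

Lemma twist_parE (t : typ tau) (x : G) :
  sg_set (par t) x <-> parJ (cut_types t) x.1 /\ base_group t x.2.
Proof. by case: t. Qed.

Lemma par_inA (t : typ tau) a : sg_set (par t) (inA a) <-> parJ (cut_types t) a.
Proof.
rewrite twist_parE; split=> [[]//|ta]; split=> //.
by case: t {ta} => //= i; apply: par1.
Qed.

Lemma par_inB (t : typ tau) b : sg_set (par t) (inB b) <-> base_group t b.
Proof.
rewrite twist_parE; split=> [[]//|tb]; split=> //.
by case: (parJ_subgroup (cut_types t)).
Qed.

(** The projection to the group of [beta] gives pairwise meeting cosets, with a
    common element [b]. After removing [b], the cosets are represented by
    elements [c t] of the group of [alpha], and [c t] determines a coset of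
    each maximal parabolic of [alpha] with type in [cut_types t]. All these
    cosets meet pairwise, so they have a common element [e], and [b] followed
    by [e] is common to the original cosets. *)
Lemma twist_helly : helly alpha -> helly beta -> helly tau.
Proof.
move=> hA hB J g meet.
have [|b bP] := hB [set i | J (inl i)] (fun i => (g (inl i)).2).
  move=> i k Ji Jk; have [z [/lcosetE zi /lcosetE zk]] := meet _ _ Ji Jk.
  exists z.2; split; apply/lcosetE.
    by have /twist_parE[] := zi.
  by have /twist_parE[] := zk.
pose c t := pact eta b^-1 (g t).1.
have gE t : J t -> sg_set (par t) ((g t)^-1 * (inB b * inA (c t))).
  move=> Jt; have -> : inB b * inA (c t) = inA (g t).1 * inB b.
    rewrite -[inA (g t).1 * inB b](mulVKg (inB b)) !mulgA -inBV.
    by have := inA_conj (g t).1 b^-1; rewrite invgK -mulgA => <-; rewrite !mulgA.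
  rewrite {1}[g t]sdprodE invgM -!mulgA mulKg -inBV -inBM; apply/par_inB.
  by case: t Jt => //= i Ji; apply: bP.
pose meetA t t' := exists z, parJ (cut_types t) ((c t)^-1 * z) /\
  parJ (cut_types t') ((c t')^-1 * z).
have cP t z : J t -> sg_set (par t) ((g t)^-1 * z) ->
    parJ (cut_types t) ((c t)^-1 * (inB b^-1 * z).1).
  move=> Jt tz; have := parM (parV (gE t Jt)) tz.
  rewrite invgM invgK -!mulgA mulVKg invgM -mulgA -inBV -inAV.
  by move=> /twist_parE [+ _]; rewrite sdM /= act1.
have meetP t t' : J t -> J t' -> meetA t t'.
  move=> Jt Jt'; have [z [/lcosetE tz /lcosetE tz']] := meet _ _ Jt Jt'.
  by exists (inB b^-1 * z).1; split; apply: cP.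
have /choice [h hP] : forall x : V, exists a, forall t, J t -> cut_types t x ->
    sg_set (par x) ((c t)^-1 * a).
  move=> x; have [[t Jt tx]|nx] := pselect (exists2 t, J t & cut_types t x);
    last by exists 1 => t Jt tx; case: nx; exists t.
  exists (c t) => t' Jt' t'x; have [z [tz t'z]] := meetP _ _ Jt Jt'.
  by have := parM (t'z x t'x) (parV (tz x tx)); rewrite invgM invgK mulgA mulgK.
have [x y [t Jt tx] [t' Jt' t'y]|e eP] :=
  hA [set x | exists2 t, J t & cut_types t x] h.
  have [z [tz t'z]] := meetP _ _ Jt Jt'.
  exists z; split; apply/lcosetE.
    have := parM (parV (hP x t Jt tx)) (tz x tx).
    by rewrite invgM invgK mulgA mulgK.
  have := parM (parV (hP y t' Jt' t'y)) (t'z y t'y).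
  by rewrite invgM invgK mulgA mulgK.
exists (inB b * inA e) => t Jt.
have := parM (gE t Jt) ((par_inA t ((c t)^-1 * e)).2 _).
rewrite inAM inAV !mulgA mulgK; apply=> x tx.
have := parM (hP x t Jt tx) (eP x _); rewrite mulgA mulgK; apply.
by exists t.
Qed.

Lemma parJ_twist (J : set (typ tau)) (x : G) :
  parJ J x <-> (forall t, J t -> parJ (cut_types t) x.1) /\
               (forall i, J (inl i) -> sg_set (par i) x.2).
Proof.
split=> [xJ|[x1 x2] t Jt].
  split=> [t /xJ /twist_parE[] //|i /xJ /twist_parE[] //].
apply/twist_parE; split; first exact: x1.
by case: t Jt => //= i /x2.
Qed.

Lemma parJ_inA (J : set (typ tau)) a :
  parJ J (inA a) <-> forall t, J t -> parJ (cut_types t) a.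
Proof. by split=> aJ t Jt; apply/par_inA/aJ. Qed.

Lemma parJ_inB (J : set (typ tau)) b :
  parJ J (inB b) <-> forall i, J (inl i) -> sg_set (par i) b.
Proof.
split=> [bJ i Ji|bJ [i|L] Jt]; try exact/par_inB.
- by have /par_inB := bJ _ Ji.
- exact/par_inB/bJ.
Qed.

Lemma twist_faithful :
  coset_faithful alpha -> coset_faithful beta -> coset_faithful tau.
Proof.
move=> fA fB x xP.
have x2 : x.2 = 1.
  apply: fB => i b; have /twist_parE[_] := xP (inl i) (inB b).
  by rewrite -inBV.
have x1 : x.1 = 1.
  apply: fA => y a; have [L Ly] := orbit_ex y.
  have /twist_parE[/(_ y Ly) + _] := xP (inr L) (inA a).
  by rewrite -inAV !sdM /= x2 act1 mul1g act1.
by case: x x1 x2 {xP} => a b /= -> ->.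
Qed.

(** The stabiliser of the base chamber of [beta] fixes the representatives. *)
Definition base_reps_fixed : Prop :=
  forall (L : orbits eta) b, parJ setT b -> tact eta b (F L) = F L.

(** Admissibility for arbitrary families: the orbits of [F L] under the maximal
    parabolics with types in [S] intersect in its orbit under [parJ S]. *)
Definition orbits_helly : Prop :=
  forall (L : orbits eta) (S : set (typ beta)) x, val L x ->
    (forall i, S i -> par_orbit F L i x) ->
    exists2 b, parJ S b & tact eta b (F L) = x.

Lemma orbits_helly_admissible : orbits_helly -> admissible F.
Proof.
move=> hF L M N; apply/seteqP; split=> [x [[b bM bx] [c cN cx]]|].
  have [||d dMN dx] := hF L (~` (M `&` N)) x.
  - by rewrite -bx; apply/orbit_act/orepP.
  - move=> i; rewrite setCI => -[nMi|nNi].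
      by exists b => //; apply: bM.
    by exists c => //; apply: cN.
  by exists d.
by move=> _ [b bMN <-]; split; exists b => // i ni; apply: bMN => -[Mi Ni];
  apply: ni.
Qed.

Lemma cut_base_rep L i : ~ cut_types (inl i) (F L).
Proof.
case=> L' _ [L'F nF]; apply: nF; rewrite -(orbit_inj (orepP F L) L'F).
exact: par_orbit_rep.
Qed.

Lemma cut_orbit_rep (L L' : orbits eta) : L <> L' -> ~ cut_types (inr L) (F L').
Proof. by move=> nLL' /= LF; apply: nLL'; apply: orbit_inj LF (orepP F L'). Qed.

(** Leaving out a type of [beta] cuts the group of [alpha] down to [parJ setT],
    and the index is the one in [beta]. Leaving out an orbit [L] allows a single
    type of [alpha], since the parabolics of [beta] together cut away all of [L]
    except [F L], and the index is the one in [alpha]. *)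
Lemma twist_thin : orbits_helly -> base_reps_fixed ->
  coset_thin alpha -> coset_thin beta -> coset_thin tau.
Proof.
move=> hF fixF tA tB [i|L].
  have [s [sC nsi sP]] := tB i; exists (inB s); split.
  - apply/parJ_inB => k nki; apply: sC => /= eqk; apply: nki.
    by rewrite eqk.
  - by move/par_inB.
  move=> x /parJ_twist [x1 x2].
  have x1T : parJ setT x.1.
    by move=> y _; have [L Ly] := orbit_ex y; apply: (x1 (inr L)).
  have sub (J : set V) : parJ J x.1 by move=> y _; apply: x1T.
  have [|x2i|x2i] := sP x.2.
  - by move=> k nki; apply: x2 => -[].
  - by left; apply/twist_parE.
  right; rewrite -inBV; apply/twist_parE; split=> //=; rewrite mul1g.
  have sT : parJ setT (pact eta s^-1 x.1) by apply: pact_parJ.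
  by move=> y _; apply: sT.
have [s [sC nsF sP]] := tA (F L); exists (inA s); split.
- apply/parJ_inA => t nt y ty; apply: sC => /= eqy; case: t nt ty => [i _|L' nL'].
    by rewrite eqy; apply: cut_base_rep.
  by rewrite eqy; apply: cut_orbit_rep => eqL; apply: nL'; rewrite eqL.
- by move=> /par_inA /(_ _ (orepP F L)).
move=> x /parJ_twist [x1 x2].
(* By [hF] for the set of all types, [F L] is the only type of [L] which lies
   in the orbits of [F L] under all maximal parabolics of [beta]. *)
have x1C : parJ (~` [set F L]) x.1.
  move=> y /= nyF; have [L' L'y] := orbit_ex y.
  have [eqL|nL] := pselect (L' = L); last first.
    by apply: (x1 (inr L')) => // -[].
  rewrite {L'}eqL in L'y.
  have [i niy] : exists i, ~ par_orbit F L i y.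
    apply/existsNP => yi; apply: nyF.
    by have [//|b bT <-] := hF L setT y L'y; apply: fixF.
  by apply: (x1 (inl i)) => //; exists L.
have xL a : parJ (~` [set F L]) a -> sg_set (par (F L)) a -> parJ (val L) a.
  move=> aC aF y Ly; have [->//|nyF] := pselect (y = F L).
  exact: aC.
have [CM CV] : (forall a a', parJ (~` [set F L]) a -> parJ (~` [set F L]) a' ->
     parJ (~` [set F L]) (a * a')) /\
   (forall a, parJ (~` [set F L]) a -> parJ (~` [set F L]) a^-1).
  by case: (parJ_subgroup (~` [set F L])).
have [//|xF|xF] := sP x.1; [left|right]; apply/twist_parE.
  by split=> //; apply: xL.
rewrite -inAV; split=> //=; rewrite act1; apply: xL => //.
by apply: CM => //; apply: CV.
Qed.

(** Let [H] be generated by the parabolics one step below [J]. It contains the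
    part [parJ S] of the group of [beta]: one step suffices if some orbit is
    missing from [J], and otherwise [beta] is residually connected. The part in
    the group of [alpha] is generated by the subgroups of corank one
    [parJ (~` [set x])] with [x] not cut away by [J]. By [orbits_helly] such an
    [x] is a translate of [F L] under [parJ S], with [L] missing from [J], so
    that only [x = F L] is left. This subgroup lies in every parabolic except
    the one of type [L], and there is a second type missing from [J]. *)
Lemma twist_generated : finite_set [set: V] -> orbits_helly ->
  coset_generated alpha -> coset_generated beta -> coset_generated tau.
Proof.
move=> finV hF gA gB J cork.
pose H := generated (\bigcup_(t in ~` J) parJ (t |` J)).
have [H1 HM HV] : is_subgroup H by apply: generated_subgroup.
have inH t x : ~ J t -> parJ (t |` J) x -> H x.
  by move=> nJt tx; apply: sub_generated; exists t.
pose full := forall L, J (inr L).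
pose S := [set i | J (inl i)].
have HB b : parJ S b -> H (inB b).
  move=> bS; have [all|/existsNP [L nJL]] := pselect full; last first.
    by apply: (inH (inr L)) => //; apply/parJ_inB => i [//|]; apply: bS.
  have cork' : exists i k, [/\ i <> k, ~ S i & ~ S k].
    case: cork => -[i|L] [[k|L'] [nik nJi nJk]]; try by exfalso; auto.
    by exists i, k; split=> // eqik; apply: nik; rewrite eqik.
  have subH : is_subgroup (inB @^-1` H).
    split=> [|c d Hc Hd|c Hc] /=; first exact: H1.
      by rewrite /= inBM; apply: HM.
    by rewrite /= inBV; apply: HV.
  apply: (generated_min subH _ (gB S cork' b bS)) => c [i nSi ci].
  apply: (inH (inl i)) => //; apply/parJ_inB => k [[->]|Jk]; apply: ci.
    by left.
  by right.
have HA a : (forall t, J t -> parJ (cut_types t) a) -> H (inA a).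
  move=> aJ; pose U := [set x | exists2 t, J t & cut_types t x].
  have aU : parJ U a by move=> x [t Jt tx]; apply: (aJ t).
  have [all|/existsNP [L nJL]] := pselect full.
    case: cork => t [_ [_ nJt _]]; apply: (inH t) => //.
    apply/parJ_inA => t' _ x _.
    by have [L Lx] := orbit_ex x; apply: (aJ (inr L)).
  have nUF M : ~ J (inr M) -> ~ U (F M).
    move=> nJM [[i|L'] Jt]; first exact: cut_base_rep.
    by apply: cut_orbit_rep => eqL; apply: nJM; rewrite -eqL.
  have cU : exists x, ~ U x by exists (F L); apply: nUF.
  have subH : is_subgroup (inA @^-1` H).
    split=> [|c d Hc Hd|c Hc] /=; first exact: H1.
      by rewrite /= inAM; apply: HM.
    by rewrite /= inAV; apply: HV.
  apply: (generated_min subH _ (parJ_generated_corank1 finV gA cU aU)).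
  move=> {L nJL aJ aU} {}a [x nUx ax] /=.
  have [L Lx] := orbit_ex x.
  have nJL : ~ J (inr L) by move=> JL; apply: nUx; exists (inr L).
  have [|c cS cx] := hF L S x Lx.
    move=> i Si; apply: contrapT => nix; apply: nUx; exists (inl i) => //.
    by exists L.
  have aE : a = pact eta c (pact eta c^-1 a) by rewrite -actM mulgV act1.
  rewrite aE -inA_conj inBV; have Hc := HB c cS.
  apply: (HM _ _ _ (HV _ Hc)); apply: HM => //.
  have : parJ (~` [set F L]) (pact eta c^-1 a).
    have := @pact_parJ_setC1 c^-1 _ _ ax.
    by rewrite -cx -actM mulVg act1.
  move: (pact eta c^-1 a) => {aE ax}a' a'F.
  have [t [nJt ntL]] : exists t, ~ J t /\ t <> inr L.
    case: cork => t [t' [ntt' nJt nJt']].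
    have [eqt|] := pselect (t = inr L); last by exists t.
    by exists t'; split=> // eqt'; apply: ntt'; rewrite eqt.
  apply: (inH t) => //; apply/parJ_inA => t' Jt' y t'y; apply: a'F => /= eqy.
  rewrite {}eqy in t'y; case: t' Jt' t'y => [i _|L' Jt']; first exact: cut_base_rep.
  apply: cut_orbit_rep => eqL; case: Jt' => [eqt|]; last by rewrite eqL.
  by apply: ntL; rewrite -eqt eqL.
move=> x /parJ_twist [x1 x2]; rewrite [x]sdprodE; apply: HM; first exact: HA.
exact: HB.
Qed.

Theorem twisting_regular_hypertope : finite_set [set: V] ->
  orbits_helly -> base_reps_fixed ->
  regular_hypertope alpha -> regular_hypertope beta ->
  regular_hypertope tau.
Proof.
move=> finV hF fixF /regular_hypertopeP [hA tA gA fA].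
move=> /regular_hypertopeP [hB tB gB fB]; apply/regular_hypertopeP; split.
- exact: twist_helly.
- exact: twist_thin.
- exact: twist_generated.
- exact: twist_faithful.
Qed.

End Twisting.

(** * Products of two dual reflections *)

Section DualReflection.
Import GRing.Theory.
Local Open Scope ring_scope.
Variables (R : fieldType) (T : Type) (k : T -> T -> R).

(** In terms of a bilinear form B with B(a_s, a_s) = 1 and simple roots a_t,
    take k s t = - 2 B(a_s, a_t) and let f t be the value of a functional at
    a_t: this is the action of the reflection in a_s on functionals. *)
Definition dual_reflection (s : T) (f : T -> R) : T -> R :=
  fun t => f t + k s t * f s.

Lemma dual_reflectionK s : k s s = -2 -> involutive (dual_reflection s).
Proof.
move=> kss f; apply/funext => t; rewrite /dual_reflection kss.
by ring.
Qed.

(** On the pair (f s, f t) the product of the two reflections has eigenvalues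
    z^2 and z^-2. Its iterates change f by multiples of the geometric sums of
    z^2 and z^-2, which vanish for n terms when z^2 is a nontrivial n-th root
    of unity. *)
Lemma dual_reflection_braid s t z n :
  k s s = -2 -> k t t = -2 -> k s t = z + z^-1 -> k t s = z + z^-1 ->
  z != 0 -> z ^+ 2 != 1 -> z ^+ 2 ^+ n = 1 ->
  forall f, iter n (fun g => dual_reflection s (dual_reflection t g)) f = f.
Proof.
move=> kss ktt kst kts z0 z21 zn f.
pose w := z ^+ 2.
have wU : z^-1 - z != 0.
  apply: contra z21 => /eqP zV; apply/eqP.
  have -> : z ^+ 2 = 1 - z * (z^-1 - z) by field.
  by rewrite zV mulr0 subr0.
(* [P] and [Q] are the coordinates of the pair along the two eigenvectors. *)
have [P [Q [PQt PQs]]] : exists P Q, P + Q = f t /\ P * z^-1 + Q * z = - f s.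
  exists ((- f s - z * f t) / (z^-1 - z)), (f t - (- f s - z * f t) / (z^-1 - z)).
  split; first by ring.
  by field; rewrite z0 mulNr -expr2 subr_eq0 eq_sym.
pose a j := \sum_(i < j) w ^+ i; pose b j := \sum_(i < j) w^-1 ^+ i.
have aE j : (w - 1) * a j = w ^+ j - 1 by exact/esym/subrX1.
have bE j : (w^-1 - 1) * b j = w^-1 ^+ j - 1 by exact/esym/subrX1.
have iterE j : iter j (fun g => dual_reflection s (dual_reflection t g)) f =
    fun u => f u + k t u * (P * a j + Q * b j) + k s u * (P * z * a j + Q / z * b j).
  elim: j => [|j IHj].
    apply/funext => u; rewrite /= /a /b !big_ord0; ring.
  rewrite iterS IHj; apply/funext => u.
  rewrite /dual_reflection kss ktt kst kts -PQt.
  have -> : f s = - (P * z^-1 + Q * z) by rewrite PQs opprK.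
  have -> : a j.+1 = a j + (1 + (w - 1) * a j).
    by rewrite aE /a big_ord_recr /=; ring.
  have -> : b j.+1 = b j + (1 + (w^-1 - 1) * b j).
    by rewrite bE /b big_ord_recr /=; ring.
  rewrite /w; field; exact: z0.
have w1 : w - 1 != 0 by rewrite subr_eq0.
have w1' : w^-1 - 1 != 0 by rewrite subr_eq0 invr_eq1.
have an : a n = 0.
  by apply: (mulfI w1); rewrite aE mulr0 zn subrr.
have bn : b n = 0.
  by apply: (mulfI w1'); rewrite bE mulr0 exprVn zn invr1 subrr.
by rewrite iterE; apply/funext => u; rewrite an bn; ring.
Qed.

End DualReflection.

Lemma braid_root m : (1 < m)%N ->
  exists z : algC, [/\ z != 0, z ^+ 2 != 1 & z ^+ 2 ^+ m = 1]%R.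
Proof.
move=> m1; have m2 : (0 < 2 * m)%N by rewrite muln_gt0 (ltnW m1).
have [z zP] := C_prim_root_exists m2; exists z; split.
- apply/eqP => z0; have := prim_expr_order zP.
  by rewrite z0 GRing.expr0n gtn_eqF // => /esym/eqP; rewrite GRing.oner_eq0.
- rewrite -(prim_order_dvd zP) -[X in _ %| X]muln1 dvdn_pmul2l //.
  by rewrite dvdn1; apply/eqP => eqm; rewrite eqm in m1.
- by rewrite -GRing.exprM (prim_expr_order zP).
Qed.

(** * Coxeter groups of finite rank *)

Section Coxeter.
Variable K : coxgraph.
Local Notation S := (vert K).
Local Notation W := (cox_group K).

Definition cprod (u : seq S) : W := foldr (fun s x => cox_gen s * x) 1 u.

Lemma cprod_pi (u : seq S) :
  cprod u = pres_pi (@cox_relators K) [seq (s, true) | s <- u].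
Proof. by elim: u => //= s u ->; rewrite -pres_piM. Qed.

Lemma cprod_cat u v : cprod (u ++ v) = cprod u * cprod v.
Proof. by elim: u => [|s u IHu] /=; rewrite ?mul1g // IHu mulgA. Qed.

Lemma cox_gen_sqr (s : S) : cox_gen s * cox_gen s = 1.
Proof.
rewrite /cox_gen /pres_gen -pres_piM; apply/pres_piP/pres_relator.
by left; exists s.
Qed.

Lemma cox_genV (s : S) : (cox_gen s)^-1 = cox_gen s.
Proof. exact/mulg1_eq/cox_gen_sqr. Qed.

Lemma cprod_rev u : cprod (rev u) = (cprod u)^-1.
Proof.
elim: u => [|s u IHu] /=; first by rewrite invg1.
by rewrite rev_cons -cats1 cprod_cat IHu /= mulg1 invgM cox_genV.
Qed.

Lemma cprod_surj (x : W) : exists u, x = cprod u.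
Proof.
rewrite -[x]pres_reprK; elim: (pres_repr x) => [|[s e] w [u uP]].
  by exists [::].
exists (s :: u); rewrite -cat1s pres_piM uP /=; congr (_ * _).
case: e => //; rewrite -[RHS]cox_genV.
by rewrite -[RHS]/(pres_invg _) [RHS]pres_inv_pi.
Qed.

Lemma braid_power (s t : S) m : s <> t -> cox_m s t = Some m ->
  (cox_gen s * cox_gen t) ^+ m = 1.
Proof.
move=> nst mst; pose r := flatten (nseq m [:: s; t]).
have <- : cprod r = (cox_gen s * cox_gen t) ^+ m.
  rewrite {}/r; elim: m {mst} => [|m IHm] //=.
  by rewrite IHm expgS mulgA.
rewrite cprod_pi; apply/pres_piP/pres_relator; right; exists s, t, m.
by split=> //; rewrite map_flatten map_nseq.
Qed.

Lemma cox_m_ge2 (s t : S) m : cox_m s t = Some m -> (1 < m)%N.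
Proof.
rewrite /cox_m; case: asboolP => [st eqm|_ [<-] //].
by have := lab_ge3 st; rewrite eqm /=; apply: ltnW.
Qed.

Section Representation.
Variables (X : Type) (h : S -> X -> X).
Hypothesis hK : forall s, involutive (h s).
Hypothesis h_braid : forall s t m, s <> t -> cox_m s t = Some m ->
  forall x, iter m (fun y => h s (h t y)) x = x.

(** Von Dyck's theorem for actions by involutions: a product of generators acts
    independently of the word that represents it. *)
Lemma cprod_act u v x : cprod u = cprod v -> foldr h x u = foldr h x v.
Proof.
pose act (w : word S) y := foldr (fun l => h l.1) y w.
have actE w y : act [seq (s, true) | s <- w] y = foldr h y w.
  by rewrite /act foldr_map.
rewrite !cprod_pi => /pres_piP uv; rewrite -!actE.
elim: uv x => {u v}
  [//|u v _ IH x|u v w _ IHu _ IHv x|u u' v v' _ IHu _ IHv x|s e x|r Rr x].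
- by rewrite IH.
- by rewrite IHu IHv.
- have cat a b : act (a ++ b) x = act a (act b x) by rewrite /act foldr_cat.
  by rewrite !cat IHu IHv.
- exact: hK.
case: Rr => [[s ->]|[s [t [m [nst mst ->]]]]]; first exact: hK.
rewrite /= -[RHS](h_braid nst mst x) /act.
by elim: m {mst} => //= m ->.
Qed.

End Representation.

Definition simple_conj (s : S) (r : W) : W := cox_gen s * r * cox_gen s.

Lemma simple_conjK s : involutive (simple_conj s).
Proof.
move=> r; rewrite /simple_conj !mulgA cox_gen_sqr mul1g -mulgA cox_gen_sqr.
by rewrite mulg1.
Qed.

(** For the word s_1 ... s_k, the elements
    (s_1 ... s_(i-1)) s_i (s_1 ... s_(i-1))^-1. *)
Fixpoint reflections (u : seq S) : seq W :=
  if u is s :: u' then cox_gen s :: map (simple_conj s) (reflections u')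
  else [::].

Lemma size_reflections u : size (reflections u) = size u.
Proof. by elim: u => //= s u IHu; rewrite size_map IHu. Qed.

Lemma mem_reflections u r : r \in reflections u ->
  exists a s b, u = a ++ s :: b /\ r = cprod a * cox_gen s * (cprod a)^-1.
Proof.
elim: u r => //= s u IHu r; rewrite inE => /orP [/eqP ->|/mapP [q qu ->]].
  by exists [::], s, u; rewrite /= invg1 mulg1 mul1g.
have [a [t [b [-> ->]]]] := IHu q qu; exists (s :: a), t, b; split=> //=.
by rewrite /simple_conj invgM cox_genV !mulgA.
Qed.

(** The involutions by which Bourbaki proves the exchange property. They act
    on all pairs of a group element and a sign; only the reflections among the
    group elements ever change their sign. *)
Definition sign_act (s : S) (x : W * bool) : W * bool :=
  (simple_conj s x.1, x.2 (+) (x.1 == cox_gen s)).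

Lemma simple_conj_eq s r q : (simple_conj s r == q) = (r == simple_conj s q).
Proof. exact: (can2_eq (simple_conjK s) (simple_conjK s)). Qed.

Lemma sign_actK s : involutive (sign_act s).
Proof.
case=> r e; rewrite /sign_act /= simple_conjK simple_conj_eq.
have -> : simple_conj s (cox_gen s) = cox_gen s.
  by rewrite /simple_conj cox_gen_sqr mul1g.
by rewrite -addbA addbb addbF.
Qed.

(** With p = s t, applying the pair of involutions m times conjugates by
    p^m = 1, and changes the sign at r once for each j < 2m with
    r = p^-j t. Since p^m = 1, the exponents j and j + m give the same
    element, so that the number of changes is even. *)
Lemma sign_act_braid s t m : s <> t -> cox_m s t = Some m ->
  forall x, iter m (fun y => sign_act s (sign_act t y)) x = x.
Proof.
move=> nst mst [r e]; set p := cox_gen s * cox_gen t.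
have pV : p^-1 = cox_gen t * cox_gen s by rewrite invgM !cox_genV.
have tp k : cox_gen t * p ^+ k = p ^- k * cox_gen t.
  elim: k => [|k IHk]; first by rewrite !expg0 invg1 mulg1 mul1g.
  have tp1 : cox_gen t * p = p^-1 * cox_gen t.
    by rewrite /p pV mulgA.
  by rewrite [in LHS]expgSr mulgA IHk -mulgA tp1 mulgA -invgM -expgS.
have conj_eq (g x : W) : (g * r * g^-1 == x) = (r == g^-1 * x * g).
  apply/eqP/eqP => [<-|->]; first by rewrite !mulgA mulVg mul1g mulgVK.
  by rewrite !mulgA mulgV mul1g mulgK.
pose q := p^-1; pose term j := r == q ^+ j * cox_gen t.
have qV k : p ^- k = q ^+ k by rewrite /q expVgn.
have iterE k : iter k (fun y => sign_act s (sign_act t y)) (r, e) =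
    (p ^+ k * r * p ^- k, e (+) \big[addb/false]_(0 <= j < k.*2) term j).
  elim: k => [|k IHk].
    by rewrite big_geq // addbF expg0 invg1 mulg1 mul1g.
  rewrite iterS IHk /sign_act /= doubleS !big_nat_recr //= -!addbA; congr (_, _).
    by rewrite /simple_conj expgS invgM pV !mulgA.
  congr (_ (+) (_ (+) (_ (+) _))).
    rewrite conj_eq -!mulgA tp !mulgA qV -expgnDr.
    by rewrite /term addnn.
  rewrite simple_conj_eq conj_eq /simple_conj -pV -!mulgA tp !mulgA !qV.
  by rewrite /term -addnn -addSn expgnDr expgSr.
rewrite iterE -addnn (@big_cat_nat _ _ _ m) ?leq_addr //=.
rewrite -[X in _ (+) \big[_/_]_(X <= _ < _) _]add0n big_addn addnK.
have qm : q ^+ m = 1 by rewrite -qV (braid_power nst mst) invg1.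
have -> : \big[addb/false]_(0 <= j < m) term (j + m) =
    \big[addb/false]_(0 <= j < m) term j.
  by apply: eq_bigr => j _; rewrite /term expgnDr qm mulg1.
by rewrite addbb addbF (braid_power nst mst) invg1 mulg1 mul1g.
Qed.

(** The sign counts how often [r] occurs among the reflections of the word. *)
Lemma foldl_sign_act u r e : foldl (fun x s => sign_act s x) (r, e) u =
  ((cprod u)^-1 * r * cprod u, e (+) odd (count_mem r (reflections u))).
Proof.
elim: u r e => [|s u IHu] r e; first by rewrite /= invg1 mulg1 mul1g addbF.
rewrite [LHS]IHu /=; congr (_, _).
  by rewrite invgM cox_genV /simple_conj !mulgA.
rewrite count_map oddD oddb addbA [cox_gen s == r]eq_sym; congr (_ (+) odd _).
by apply: eq_count => q /=; rewrite simple_conj_eq.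
Qed.

Lemma reflection_parity u v r : cprod u = cprod v ->
  odd (count_mem r (reflections u)) = odd (count_mem r (reflections v)).
Proof.
move=> uv; have ruv : cprod (rev u) = cprod (rev v) by rewrite !cprod_rev uv.
have := cprod_act sign_actK sign_act_braid (r, false) ruv.
have foldrE w : foldr sign_act (r, false) (rev w) =
    foldl (fun x s => sign_act s x) (r, false) w.
  by rewrite -(foldl_rev (fun x s => sign_act s x)) revK.
by rewrite !foldrE !foldl_sign_act => -[].
Qed.

(** An element that occurs once among the reflections of [u] occurs an odd
    number of times among those of [v]. *)
Lemma size_uniq_reflections u v :
  uniq (reflections u) -> cprod u = cprod v -> (size u <= size v)%N.
Proof.
move=> Uu uv; rewrite -size_reflections -[size v]size_reflections.
apply: uniq_leq_size => // r ru; rewrite -has_pred1 has_count.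
apply: odd_gt0; rewrite -(reflection_parity r uv).
by rewrite count_uniq_mem ?ru.
Qed.

(** Two equal reflections in a word mean that the letters at their positions
    can both be deleted. *)
Lemma reflections_deletion u : ~~ uniq (reflections u) ->
  exists v, [/\ subseq v u, (size v < size u)%N & cprod v = cprod u].
Proof.
elim: u => //= s u IHu; rewrite negb_and negbK => /orP [/mapP [r ru eqs]|].
  have {eqs} eqr : r = cox_gen s.
    apply: (inv_inj (simple_conjK s)); rewrite -eqs.
    by rewrite /simple_conj cox_gen_sqr mul1g.
  have [a [t [b [-> rE]]]] := mem_reflections ru.
  exists (a ++ b); split.
  - apply: subseq_trans (subseq_cons _ s); apply: cat_subseq => //.
    exact: subseq_cons.
  - by rewrite !size_cat /= addnS ltnS -addnS leq_add2l.
  rewrite !cprod_cat /= -eqr rE !mulgA mulgVK -[_ * cox_gen t * cox_gen t]mulgA.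
  by rewrite cox_gen_sqr mulg1.
rewrite (map_inj_uniq (inv_inj (simple_conjK s))) => /IHu [v [vu szv eqv]].
by exists (s :: v); split; rewrite /= ?eqxx ?eqv.
Qed.

(** These are the shortest words for their product, by
    [size_uniq_reflections] and [reflections_deletion]. *)
Definition reduced (u : seq S) : Prop := uniq (reflections u).

Lemma reduced_subseq u :
  exists v, [/\ subseq v u, reduced v & cprod v = cprod u].
Proof.
have [n] := ubnP (size u); elim: n u => // n IHn u szu.
have [Uu|nUu] := boolP (uniq (reflections u)); first by exists u.
have [v [vu szv eqv]] := reflections_deletion nUu.
have [|w [wv Uw eqw]] := IHn v; first exact: leq_trans szv _.
by exists w; split; [apply: subseq_trans wv vu | | rewrite eqw].
Qed.

Definition word_over (X : set S) (u : seq S) : Prop := forall s, s \in u -> X s.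

Lemma word_over_cons X s u : word_over X (s :: u) <-> X s /\ word_over X u.
Proof.
split=> [Xu|[Xs Xu] t]; last by rewrite inE => /orP [/eqP ->|/Xu].
by split=> [|t tu]; apply: Xu; rewrite inE ?eqxx ?tu ?orbT.
Qed.

Lemma word_over_cat X u v :
  word_over X (u ++ v) <-> word_over X u /\ word_over X v.
Proof.
split=> [Xuv|[Xu Xv] s]; last by rewrite mem_cat => /orP [/Xu|/Xv].
by split=> s su; apply: Xuv; rewrite mem_cat su ?orbT.
Qed.

Lemma word_over_subseq X u v : subseq v u -> word_over X u -> word_over X v.
Proof. by move=> /mem_subseq vu Xu s /vu /Xu. Qed.

Definition standard_parabolic (X : set S) : set W :=
  [set cprod u | u in word_over X].

(** The indicator function of [s] is fixed by the dual reflections of all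
    generators except [s], and changes sign under that of [s]. The coefficients
    of the representation need only make the braid relations hold; for label
    [m] they are z + z^-1 with z a primitive root of unity of order 2m. *)
Lemma cox_gen_notin_others (s : S) u :
  cox_gen s = cprod u -> ~ word_over [set~ s] u.
Proof.
have /choice [root rootP] : forall m, exists z : algC, (1 < m)%N ->
    [/\ z != 0, z ^+ 2 != 1 & z ^+ 2 ^+ m = 1]%R.
  move=> m; have [m1|m1] := boolP (1 < m)%N; last by exists 0%R.
  by have [z zP] := braid_root m1; exists z.
pose k (x y : S) : algC := if x == y then (-2)%R else
  if cox_m x y is Some m then (root m + (root m)^-1)%R else 0%R.
have mC (x y : S) : cox_m x y = cox_m y x.
  rewrite /cox_m; case: asboolP => xy; case: asboolP => yx //.
  - exact: lab_sym.
  - by case: yx; apply: adj_sym.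
  - by case: xy; apply: adj_sym.
have kss x : k x x = (-2)%R by rewrite /k eqxx.
have kK x : involutive (dual_reflection k x) by apply: dual_reflectionK.
have k_braid x y m : x <> y -> cox_m x y = Some m -> forall f,
    iter m (fun g => dual_reflection k x (dual_reflection k y g)) f = f.
  move=> nxy mxy; have /rootP [z0 z21 zm] := cox_m_ge2 mxy.
  have kxy : k x y = (root m + (root m)^-1)%R.
    by rewrite /k mxy; case: eqP.
  have kyx : k y x = (root m + (root m)^-1)%R.
    by rewrite /k mC mxy; case: eqP => // /esym.
  exact: dual_reflection_braid kxy kyx z0 z21 zm.
move=> su over.
pose f (x : S) : algC := (x == s)%:R%R.
have fixf : foldr (dual_reflection k) f u = f.
  elim: u over {su} => //= t u IHu /word_over_cons [nts /IHu ->].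
  apply/funext => x; rewrite /dual_reflection /f.
  have -> : (t == s) = false by apply/eqP.
  by rewrite GRing.mulr0 GRing.addr0.
have : cprod [:: s] = cprod u by rewrite /= mulg1.
move=> /(cprod_act kK k_braid f); rewrite fixf => /(congr1 (@^~ s)) /=.
rewrite /dual_reflection kss /f eqxx GRing.mulr1.
move/eqP; rewrite -GRing.subr_eq0 [(_ + _ - _)%R]GRing.addrAC GRing.subrr.
by rewrite GRing.add0r GRing.oppr_eq0 Num.Theory.pnatr_eq0.
Qed.

Lemma standard_parabolic_subgroup (X : set S) :
  is_subgroup (standard_parabolic X).
Proof.
split=> [|_ _ [u Xu <-] [v Xv <-]|_ [u Xu <-]]; first by exists [::].
  by exists (u ++ v); rewrite ?cprod_cat //; apply/word_over_cat.
by exists (rev u); rewrite ?cprod_rev // => s; rewrite mem_rev; apply: Xu.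
Qed.

Lemma standard_parabolic_gen (X : set S) s :
  standard_parabolic X (cox_gen s) <-> X s.
Proof.
split=> [[u Xu us]|Xs]; last first.
  by exists [:: s]; [apply/word_over_cons | rewrite /= mulg1].
apply: contrapT => nXs; apply: (cox_gen_notin_others (esym us)) => t tu /= ets.
by apply: nXs; rewrite -ets; apply: Xu.
Qed.

(** Let [s :: u] be reduced with product in W_X, and let [x] be a reduced word
    over [X] for it. Then [s :: x] is longer than the word [u] with the same
    product, hence not reduced, and [s] is one of the reflections of [x]. So
    [s] belongs to W_X, hence to [X], and [u] is treated by induction. *)
Lemma standard_parabolic_reduced (X : set S) u :
  reduced u -> standard_parabolic X (cprod u) -> word_over X u.
Proof.
elim: u => // s u IHu Usu [x0 Xx0 eqx0].
have [x [xx0 Ux eqx]] := reduced_subseq x0.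
have Xx := word_over_subseq xx0 Xx0.
have sqr : cprod (s :: x) = cprod u.
  by rewrite /= eqx eqx0 /= mulgA cox_gen_sqr mul1g.
have nUsx : ~~ uniq (reflections (s :: x)).
  apply/negP => Usx; have xu := size_uniq_reflections Usx sqr.
  have ux := size_uniq_reflections Usu (esym (etrans eqx eqx0)).
  by have := leq_trans xu (ltnW ux); rewrite ltnn.
have {nUsx} sx : cox_gen s \in reflections x.
  move: nUsx; rewrite /= (map_inj_uniq (inv_inj (simple_conjK s))).
  rewrite [uniq _]Ux andbT negbK => /mapP [r rx rE].
  have <- // : r = cox_gen s.
  apply: (inv_inj (simple_conjK s)); rewrite -rE.
  by rewrite /simple_conj cox_gen_sqr mul1g.
have Xs : X s.
  have [a [t [b [xE gE]]]] := mem_reflections sx.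
  move: Xx; rewrite xE => /word_over_cat [Xa /word_over_cons [Xt _]].
  apply/standard_parabolic_gen; rewrite gE.
  have [_ XM XV] := standard_parabolic_subgroup X.
  apply: (XM); last by apply: XV; exists a.
  by apply: XM; [exists a | apply/standard_parabolic_gen].
apply/word_over_cons; split=> //; apply: IHu.
  move: Usu; rewrite /reduced /= (map_inj_uniq (inv_inj (simple_conjK s))).
  by case/andP.
by exists (s :: x); [apply/word_over_cons | ].
Qed.

(** A reduced word obtained by deleting letters from a word for [y] followed by
    one for [z] still splits at the same place. *)
Lemma standard_parabolic_factor (X Y Z : set S) y z :
  standard_parabolic Y y -> standard_parabolic Z z ->
  standard_parabolic X (y * z) ->
  exists y' z', [/\ y * z = y' * z', standard_parabolic (X `&` Y) y'
                  & standard_parabolic (X `&` Z) z'].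
Proof.
move=> [u Yu <-] [v Zv <-]; rewrite -cprod_cat => Xuv.
have [w [wuv Uw eqw]] := reduced_subseq (u ++ v).
move: Xuv; rewrite -{}eqw => /(standard_parabolic_reduced Uw).
have /subseqP [m szm wE] := wuv.
have : w = mask (take (size u) m) u ++ mask (drop (size u) m) v.
  rewrite wE -{1}[m](cat_take_drop (size u)) mask_cat // size_takel //.
  by rewrite szm size_cat leq_addr.
set u' := mask _ u; set v' := mask _ v => -> /word_over_cat [Xu' Xv'].
exists (cprod u'), (cprod v'); rewrite cprod_cat; split=> //.
  exists u' => // s su'; split; first exact: Xu'.
  by apply: (word_over_subseq _ Yu su'); apply: mask_subseq.
exists v' => // s sv'; split; first exact: Xv'.
by apply: (word_over_subseq _ Zv sv'); apply: mask_subseq.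
Qed.

Lemma cox_parabolicE (s : S) :
  cox_parabolic s = standard_parabolic [set~ s] :> set W.
Proof.
apply/seteqP; split=> x.
  apply: generated_min; first exact: standard_parabolic_subgroup.
  by move=> _ [t ts <-]; apply/standard_parabolic_gen.
move=> [u us <-]; have [p1 pM _] := sgP (cox_parabolic s).
elim: u us => //= t u IHu /word_over_cons [ts /IHu us]; apply: pM => //.
by apply: sub_generated; exists t.
Qed.

Lemma cox_parE (s : typ (cox_cosys K)) w :
  sg_set (par s) w <-> standard_parabolic [set~ s] w.
Proof. by rewrite -cox_parabolicE. Qed.

Lemma cox_parJE (J : set (typ (cox_cosys K))) :
  parJ J = standard_parabolic (~` J) :> set W.
Proof.
apply/seteqP; split=> w wJ; last first.
  move=> s Js; apply/cox_parE; case: wJ => u uJ <-; exists u => // t tu /= ets.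
  by apply: (uJ t tu); rewrite ets.
have [u0 eqw] := cprod_surj w.
have [u [_ Uu equ]] := reduced_subseq u0; exists u; last by rewrite equ.
move=> s su Js; have /cox_parE := wJ s Js.
by rewrite eqw -equ => /(standard_parabolic_reduced Uu)/(_ s su); apply.
Qed.

(** Given an element [x] common to the cosets treated so far, and one more coset
    [g i W_i], one looks for [x y] in that coset with [y] in all the parabolics
    already treated. Starting from [y = x^-1 g i], the parabolics are treated one
    after the other: since the coset of type [k] meets that of type [i], [y]
    factors through W_k W_i, and [standard_parabolic_factor] allows replacing
    it by its first factor. *)
Lemma cox_helly : finite_set [set: S] -> helly (cox_cosys K).
Proof.
move=> finS J g meet.
have [s sP] : exists s : seq S, forall x, x \in s.
  have /finite_seqP [s sE] := finS.
  by exists s => x; have : [set` s] x by rewrite -sE.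
suff [x xP] : exists x : W, forall i : typ (cox_cosys K),
    (i : S) \in s -> J i -> sg_set (par i) ((g i)^-1 * x).
  by exists x => i; apply: xP.
elim: s {sP} => [|i l [x xP]]; first by exists 1.
have [Ji|nJi] := pselect (J i); last first.
  by exists x => k; rewrite inE => /orP [/eqP -> //|]; apply: xP.
suff [y [yi yl]] : exists y : W,
    sg_set (par (i : typ (cox_cosys K))) ((g i)^-1 * x * y) /\
    forall k : typ (cox_cosys K), (k : S) \in l -> J k -> sg_set (par k) y.
  exists (x * y) => k; rewrite inE => /orP [/eqP -> _|kl Jk]; first by rewrite mulgA.
  by rewrite mulgA; apply: parM; [apply: xP | apply: yl].
have sub : {subset l <= l} by [].
(* [l'] is the list of the types for which [y] has been adjusted. *)
elim: {1 3}l sub => [_|k l' IHl' sub].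
  by exists (x^-1 * g i); rewrite mulgA mulgK mulVg; split=> //; apply: par1.
have [|y [yi yl]] := IHl'.
  by move=> t tl'; apply: sub; rewrite inE tl' orbT.
have [Jk|nJk] := pselect (J k); last first.
  by exists y; split=> // t; rewrite inE => /orP [/eqP -> //|]; apply: yl.
have [z [/lcosetE zi /lcosetE zk]] := meet i k Ji Jk.
have kl : k \in l by apply: sub; rewrite inE eqxx.
have xz : sg_set (par (k : typ (cox_cosys K))) (x^-1 * z).
  by have := parM (parV (xP k kl Jk)) zk; rewrite invgM invgK mulgA mulgK.
have zy : sg_set (par (i : typ (cox_cosys K))) (z^-1 * x * y).
  by have := parM (parV zi) yi; rewrite invgM invgK !mulgA mulgK.
have yE : y = (x^-1 * z) * (z^-1 * x * y) by rewrite !mulgA mulgK mulVg mul1g.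
have yl' : standard_parabolic (~` [set t | t \in l' /\ J t]) y.
  by rewrite -cox_parJE => t [tl' Jt]; apply: yl.
rewrite yE in yl'.
have [p [q [pqE pP qP]]] :=
  standard_parabolic_factor ((cox_parE _ _).1 xz) ((cox_parE _ _).1 zy) yl'.
rewrite -yE in pqE.
have pE : p = y * q^-1 by rewrite pqE mulgK.
exists p; split.
  rewrite pE mulgA; apply: parM => //; apply/parV/cox_parE.
  by case: qP => u uq <-; exists u => // t /uq [].
move=> t; rewrite inE => /orP [/eqP -> _|tl' Jt].
  by apply/cox_parE; case: pP => u up <-; exists u => // r /up [].
apply/cox_parE; case: pP => u up <-; exists u => // r /up [nr _] /= ert.
by apply: nr; rewrite ert.
Qed.

Lemma cox_thin : coset_thin (cox_cosys K).
Proof.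
move=> i; exists (cox_gen i); rewrite cox_parJE setCK; split.
- exact/standard_parabolic_gen.
- by move=> /cox_parE/standard_parabolic_gen; apply.
move=> _ [u ui <-]; suff [->|->] : cprod u = 1 \/ cprod u = cox_gen i.
- by left; apply: par1.
- by right; rewrite mulVg; apply: par1.
elim: u ui => [|s u IHu]; first by left.
move=> /word_over_cons [-> /IHu [] /= ->]; first by right; rewrite mulg1.
by left; rewrite cox_gen_sqr.
Qed.

Lemma cox_generated : coset_generated (cox_cosys K).
Proof.
move=> J [i [k [nik nJi nJk]]]; rewrite cox_parJE => _ [u uJ <-].
have [H1 HM _] := generated_subgroup
  (\bigcup_(i in ~` J) @parJ (cox_cosys K) (i |` J)).
elim: u uJ => //= s u IHu /word_over_cons [nJs /IHu Hu]; apply: HM => //.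
have [t [nJt nts]] : exists t, ~ J t /\ t <> s.
  by have [<-|nis] := pselect (i = s); [exists k|exists i]; split=> // /esym.
apply: sub_generated; exists t => //; rewrite cox_parJE.
by apply/standard_parabolic_gen => -[/esym|].
Qed.

Lemma cox_faithful : coset_faithful (cox_cosys K).
Proof.
move=> w wP; have : @parJ (cox_cosys K) setT w.
  by move=> i _; have := wP i 1; rewrite invg1 mul1g mulg1.
rewrite cox_parJE => -[[|s u] //= /word_over_cons [] /(_ I)].
by [].
Qed.

Theorem cox_regular_hypertope : finite_set [set: S] ->
  regular_hypertope (cox_cosys K).
Proof.
move=> finS; apply/regular_hypertopeP; split.
- exact: cox_helly.
- exact: cox_thin.
- exact: cox_generated.
- exact: cox_faithful.
Qed.

End Coxeter.

(** * Diagonal extensions *)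

Section ParabolicStabilizers.
Variables (alpha beta : cosys) (eta : parabolic_action alpha beta).
Variable F : orbit_choice eta.

Definition parabolic_stabilizers : Prop := forall L : orbits eta,
  (forall b, tact eta b (F L) = F L) \/
  (exists j, forall b, tact eta b (F L) = F L <-> sg_set (par j) b).

Lemma orbit_from_rep (L : orbits eta) x : val L x ->
  exists c, x = tact eta c (F L).
Proof.
move: (F L) (orepP F L) => y; case: L => L LP /=; have [k /= ->] := set_mem LP.
move=> [c _ <-] [d _ <-].
by exists (d * c^-1); rewrite -actM mulgVK.
Qed.

(** Suppose that the stabiliser is [par j]. An element [x = c F_L] of the orbits
    of F_L under all [par i], [i] in [S], corresponds to a coset of [par j] which
    meets these [par i]; an element common to all of them is the required
    member of [parJ S]. *)
Lemma stabilizers_orbits_helly :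
  parabolic_stabilizers -> helly beta -> orbits_helly F.
Proof.
move=> stab hB L S x Lx xP.
have S1 : parJ S 1 by move=> i _; apply: par1.
have [c xE] := orbit_from_rep Lx.
have [fixF|[j jP]] := stab L.
  by exists 1; rewrite // act1 xE fixF.
have [Sj|nSj] := pselect (S j).
  by have [b jb <-] := xP j Sj; exists 1; rewrite // act1; apply/esym/jP.
pose g i := if `[< i = j >] then c else 1.
have gS i : S i -> g i = 1.
  by move=> Si; rewrite /g asboolF // => eqij; apply: nSj; rewrite -eqij.
have gj : g j = c by rewrite /g asboolT.
have self (i : typ beta) h : lcoset h (par i) h.
  by apply/lcosetE; rewrite mulVg; apply: par1.
have meetj i : S i -> lcoset 1 (par i) `&` lcoset c (par j) !=set0.
  move=> Si; have [b ib bx] := xP i Si; exists b; split; apply/lcosetE.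
    by rewrite invg1 mul1g.
  by apply/jP; rewrite actM bx xE -actM mulVg act1.
have [|y yP] := hB (j |` S) g.
  move=> i k [->|Si] [->|Sk]; rewrite ?gj ?gS //.
  - by exists c.
  - by rewrite setIC; apply: meetj.
  - exact: meetj.
  - by exists 1.
exists y.
  by move=> i Si; have := yP i (or_intror Si); rewrite gS // invg1 mul1g.
have /jP := yP j (or_introl erefl); rewrite gj xE => cy.
by rewrite -{2}cy -actM mulVKg.
Qed.

Lemma stabilizers_base_fixed : parabolic_stabilizers -> base_reps_fixed F.
Proof.
move=> stab L b bT; have [->//|[j jP]] := stab L.
by apply/jP; apply: bT.
Qed.

End ParabolicStabilizers.

Section DiagonalExtension.
Variables (beta : cosys) (j : typ beta) (lambda : diag_label j).
Variables (G : coxgraph) (v : vert G).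
Local Notation K := (diag_ext lambda v).

Lemma diag_ext_finite : finite_set (lcosets (par j)) ->
  finite_set [set: vert G] -> finite_set [set: vert K].
Proof.
move=> finX finG.
have -> : [set: vert K] = inl @` [set: {w : vert G | w != v}] `|`
    inr @` [set: coset_space (par j)].
  by apply/seteqP; split=> // -[w|X] _; [left; exists w|right; exists X].
rewrite finite_setU; split; apply: finite_image.
  have -> : [set: {w : vert G | w != v}] = val @^-1` [set: vert G] by [].
  by apply: finite_preimage => // x y _ _; apply: val_inj.
have -> : [set: coset_space (par j)] = val @^-1` lcosets (par j).
  by apply/seteqP; split=> // -[X XP] _; apply: (set_mem XP).
by apply: finite_preimage => // x y _ _; apply: val_inj.
Qed.

Variables (A : groupType) (p : vert K -> subgroup A).
Variable eta : parabolic_action (CoSys p) beta.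
Hypothesis eta_tact : forall b s, tact eta b s = diag_ext_act b s.

(** A representative in the diagonal part belongs to the orbit of all cosets of
    [par j], so it is [par j] itself, whose stabiliser is [par j]. *)
Lemma diag_ext_stabilizers (F : orbit_choice eta) :
  (forall L : orbits eta,
     val L = diag_orbit lambda v -> F L = diag_base lambda v) ->
  parabolic_stabilizers F.
Proof.
move=> FP L; case FL : (F L : vert K) => [w|X]; [left=> b|right; exists j => b].
  by rewrite eta_tact.
have LX : val L (inr X) by rewrite -FL; apply: orepP.
have eqL : val L = diag_orbit lambda v.
  case: L LX {FL} => L LP /=; have [k /= ->] := set_mem LP => -[b0 _].
  rewrite eta_tact; case: k => // X0 _.
  apply/seteqP; split=> [_ [c _ <-]|_ [Y _ <-]].
    by rewrite eta_tact; eexists.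
  have [/= g gE] := set_mem (valP X0); have [/= h hE] := set_mem (valP Y).
  exists (h * g^-1) => //; rewrite eta_tact; congr inr; apply: val_inj => /=.
  by rewrite gE -lcosetM mulgVK hE.
have [XE] : inr X = diag_base lambda v by rewrite -FL; apply: FP.
rewrite eta_tact XE /=; split=> [[eqb]|jb].
  have /esym := eqb; rewrite -{1}[sg_set _]lcoset1.
  by move=> /(lcoset_eqP _ _ (sgP _)); rewrite invg1 mul1g.
congr inr; apply: val_inj => /=; rewrite -[RHS]lcoset1.
by apply/esym/lcoset_eqP; [apply: sgP | rewrite invg1 mul1g].
Qed.

(** Stated for every coset system with these types and this action on them, so
    as to apply to the Coxeter system and to its quotients. *)
Lemma diag_ext_twisting (F : orbit_choice eta) :
  regular_hypertope beta -> regular_hypertope (CoSys p) ->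
  finite_set [set: vert K] ->
  (forall L : orbits eta,
     val L = diag_orbit lambda v -> F L = diag_base lambda v) ->
  admissible F /\ regular_hypertope (twisting F).
Proof.
move=> hbeta halpha finK FP; have stab := diag_ext_stabilizers FP.
have hB : helly beta by case/regular_hypertopeP: (hbeta).
have hF := stabilizers_orbits_helly stab hB.
split; first exact: orbits_helly_admissible.
by apply: twisting_regular_hypertope => //; apply: stabilizers_base_fixed.
Qed.

End DiagonalExtension.

Theorem theorem3p13
    (beta : cosys) (hbeta : regular_hypertope beta)
    (j : typ beta)
    (Xj_finite : finite_set (lcosets (par j)))
    (Xj_gt1 : exists X Y : coset_space (par j), X <> Y)
    (lambda : diag_label j)
    (G : coxgraph) (G_finite : finite_set [set: vert G]) (v : vert G) :
  let K := diag_ext lambda v in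
  let alpha := cox_cosys K in
  let eta : parabolic_action alpha beta := diag_ext_action lambda v in
  (forall F : orbit_choice eta,
     (forall L : orbits eta,
        val L = diag_orbit lambda v -> F L = diag_base lambda v) ->
     admissible F /\ regular_hypertope (twisting F)) /\
  (forall (M : subgroup (grp alpha)) (hM : forall b, pact eta b @` M = M),
     let N : normal_subgroup (grp alpha) := nclosure M in
     let eta' : parabolic_action (quot_cosys N) beta :=
       quot_parabolic_action (normal_closure_stable hM) in
     regular_hypertope (quot_cosys N) ->
     forall F : orbit_choice eta',
       (forall L : orbits eta',
          val L = diag_orbit lambda v -> F L = diag_base lambda v) ->
       admissible F /\ regular_hypertope (twisting F)).
Proof.
move=> K alpha eta; have finK := diag_ext_finite lambda v Xj_finite G_finite.
split=> [F FP|M hM N eta' hN F FP].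
  have halpha : regular_hypertope alpha by apply: cox_regular_hypertope.
  exact: (diag_ext_twisting _ hbeta halpha finK FP).
exact: (diag_ext_twisting _ hbeta hN finK FP).
Qed.
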